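(* Let $n\ge1$, let $K_n$ be the $n$-dimensional Klein bottle, and let $\beta_i=\dim_{\mathbb{Q}}H_i(K_n;\mathbb{Q})$ be its $i$-th rational Betti number. Then $$\beta_i=\begin{cases}\binom{n-1}{i}&\text{if } i \text{ is even},\\[2pt] \binom{n-1}{i-1}&\text{if } i\text{ is odd}.\end{cases}$$
   Context: The $n$-dimensional Klein bottle is $K_n=(S^1)^n/\big((z_1,\dots,z_{n-1},z_n)\sim(\bar z_1,\dots,\bar z_{n-1},-z_n)\big)$, where $S^1\subset\mathbb{C}$ is the unit circle. Binomial coefficients $\binom{a}{b}$ are $0$ when $b<0$ or $b>a$; $i\ge 0$. *)

(* Defs.v *)
From HB Require Import structures.
From mathcomp Require Import all_boot all_order all_algebra.
From mathcomp Require Import complex freeg.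
From mathcomp Require Import all_classical all_reals topology normedtype.

Set Implicit Arguments.
Unset Strict Implicit.
Unset Printing Implicit Defensive.

Import Order.TTheory GRing.Theory Num.Theory.
Import numFieldNormedType.Exports.

Local Open Scope classical_set_scope.
Local Open Scope ring_scope.
Local Open Scope quotient_scope.

Section LmoduleQuotient.
Variables (F : nzRingType) (V : lmodType F) (S : submodClosed V).

(* [submodClosed] also serves semimodules, so that it does not entail closure *)
(* under opposite, and [Quotient.quot] only carries a zmodType structure.     *)
Definition submod_zmodClosed : zmodClosed V :=
  HB.pack_for (zmodClosed V) (GRing.SubmodClosed.sort S)
    (GRing.isZmodClosed.Build V _ (GRing.submod_closedB (GRing.submodClosedP S))).

Local Notation quot := (Quotient.quot submod_zmodClosed).

Definition lquot : Type := quot.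

HB.instance Definition _ := GRing.Zmodule.on lquot.

Definition lquot_pi (v : V) : lquot := \pi_(quot) v.

Definition lquot_scale (a : F) (x : lquot) : lquot :=
  lquot_pi (a *: repr (x : quot)).

Lemma lquot_piE (u v : V) : (lquot_pi u == lquot_pi v) = (u - v \in S).
Proof. exact/esym/(Quotient.idealrBE submod_zmodClosed). Qed.

Lemma lquot_piP (x : lquot) : exists v, x = lquot_pi v.
Proof. by exists (repr (x : quot)); rewrite /lquot_pi reprK. Qed.

Lemma lquot_piD : {morph lquot_pi : u v / u + v}.
Proof. by move=> u v; rewrite /lquot_pi [LHS]pi_addr. Qed.

Lemma lquot_piZ (a : F) (v : V) : lquot_pi (a *: v) = lquot_scale a (lquot_pi v).
Proof.
apply/eqP; rewrite lquot_piE -scalerBr; apply: rpredZ.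
by rewrite -lquot_piE /lquot_pi reprK.
Qed.

Fact lquot_scaleA (a b : F) (x : lquot) :
  lquot_scale a (lquot_scale b x) = lquot_scale (a * b) x.
Proof. by have [v ->] := lquot_piP x; rewrite -!lquot_piZ scalerA. Qed.

Fact lquot_scale1 : left_id 1 lquot_scale.
Proof. by move=> x; have [v ->] := lquot_piP x; rewrite -lquot_piZ scale1r. Qed.

Fact lquot_scaleDr : right_distributive lquot_scale +%R.
Proof.
move=> a x y; have [u ->] := lquot_piP x; have [v ->] := lquot_piP y.
by rewrite -lquot_piD -!lquot_piZ scalerDr lquot_piD.
Qed.

Fact lquot_scaleDl (x : lquot) : {morph lquot_scale^~ x : a b / a + b}.
Proof.
by move=> a b; have [v ->] := lquot_piP x; rewrite -!lquot_piZ scalerDl lquot_piD.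
Qed.

HB.instance Definition _ := GRing.Zmodule_isLmodule.Build F lquot
  lquot_scaleA lquot_scale1 lquot_scaleDr lquot_scaleDl.

End LmoduleQuotient.

(* V is finite dimensional, of dimension b *)
Definition has_dim (F : fieldType) (V : lmodType F) (b : nat) : Prop :=
  exists e : 'I_b -> V,
    (forall a : 'I_b -> F, \sum_i a i *: e i = 0 -> forall i, a i = 0) /\
    (forall v : V, exists a : 'I_b -> F, v = \sum_i a i *: e i).

Lemma has_dim_leq (F : fieldType) (V : lmodType F) b c :
  has_dim V b -> has_dim V c -> (b <= c)%N.
Proof.
move=> [e [free_e _]] [f [_ span_f]].
have [A eE] : exists A : 'M[F]_(b, c), forall i, e i = \sum_j A i j *: f j.
  have [A AP] := @choice _ _ _ (fun i => span_f (e i)).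
  exists (\matrix_(i, j) A i j) => i.
  by rewrite AP; apply: eq_bigr => j _; rewrite mxE.
suff : row_free A by rewrite /row_free => /eqP <-; exact: rank_leq_col.
apply: inj_row_free => v vA0; apply/rowP => i; rewrite mxE.
apply: (free_e (v 0)); under eq_bigr do rewrite eE scaler_sumr.
rewrite exchange_big big1// => j _.
under eq_bigr do rewrite scalerA.
by rewrite -scaler_suml; have /rowP/(_ j) := vA0; rewrite !mxE => ->; rewrite scale0r.
Qed.

Lemma has_dim_unique (F : fieldType) (V : lmodType F) b c :
  has_dim V b -> has_dim V c -> b = c.
Proof. by move=> Vb Vc; apply/eqP; rewrite eqn_leq !(@has_dim_leq _ V). Qed.

Section Simplices.
Variable R : realType.

Definition simplex (k : nat) : set 'rV[R]_k.+1 :=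
  [set t | (forall i, 0 <= t 0 i) /\ \sum_i t 0 i = 1].
Arguments simplex : clear implicits.

Definition insert0 k (i : 'I_k.+2) (t : 'rV[R]_k.+1) : 'rV[R]_k.+2 :=
  \row_j (if unlift i j is Some j' then t 0 j' else 0).

Lemma insert0P k (i : 'I_k.+2) (t : simplex k) :
  insert0 i (set_val t) \in simplex k.+1.
Proof.
case: t => t tS /=; have [t_ge0 sum_t] := set_mem tS.
apply/mem_set; split=> [j|].
  by rewrite mxE; case: unliftP.
rewrite (bigD1_ord i) //= mxE unlift_none add0r -[RHS]sum_t.
by apply: eq_bigr => j _; rewrite mxE liftK.
Qed.

Definition face k (i : 'I_k.+2) (t : simplex k) : simplex k.+1 :=
  exist _ (insert0 i (set_val t)) (insert0P i t).

Lemma insert0_continuous k (i : 'I_k.+2) : continuous (@insert0 k i).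
Proof.
move=> t /= A /nbhs_ballP [e /= e0 eA].
apply/nbhs_ballP; exists e => //= s [_ ts]; apply: eA; split=> // a j.
rewrite !mxE; case: unlift => [j'|]; last exact: ballxx.
exact: ts.
Qed.

Lemma face_continuous k (i : 'I_k.+2) : continuous (@face k i).
Proof.
apply: continuous_comp_initial => t.
apply: (@continuous_comp _ _ _ set_val (insert0 i)).
  exact: (@initial_continuous (simplex k) _ set_val).
exact: insert0_continuous.
Qed.

HB.instance Definition _ k (i : 'I_k.+2) :=
  isContinuous.Build _ _ (@face k i) (@face_continuous k i).

End Simplices.
Arguments simplex : clear implicits.

Lemma fglift_linear (F : nzRingType) (K : choiceType) (V : lmodType F)
  (f : K -> V) : linear (fglift f).
Proof.
move=> a C D; have liftD : {morph fglift f : x y / x + y}.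
  have lift0 : fglift f 0 = 0 by rewrite -(subrr 0) lift_is_additive subrr.
  move=> x y; rewrite -[y in LHS]opprK lift_is_additive.
  by rewrite -(sub0r y) lift_is_additive lift0 sub0r opprK.
rewrite liftD; congr (_ + _).
have lift0 : fglift f 0 = 0 by rewrite -(subrr 0) lift_is_additive subrr.
have -> : fglift f C = \sum_(x <- dom C) coeff x C *: f x.
  rewrite -[C in LHS]freeg_sumE (big_morph _ liftD lift0).
  by apply: eq_bigr => x _; rewrite liftU.
rewrite scaler_sumr.
rewrite [a *: C]/GRing.scale /= /fgscale (big_morph _ liftD lift0).
by apply: eq_bigr => x _; rewrite !liftU scalerA.
Qed.

Section SingularHomology.
Variables (R : realType) (F : fieldType) (X : topologicalType).

Definition singular_simplex (k : nat) := continuousType (simplex R k) X.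

HB.instance Definition _ k := Choice.on (singular_simplex k).

Definition chain (k : nat) : lmodType F := {freeg (singular_simplex k) / F}.

Definition boundary (k : nat) : chain k.+1 -> chain k :=
  fglift (fun s : singular_simplex k.+1 =>
    \sum_(i < k.+2) (-1) ^+ i *: << (s \o face i : singular_simplex k) >>).

HB.instance Definition _ k :=
  GRing.isLinear.Build F (chain k.+1) (chain k) _ (@boundary k)
    (fglift_linear _).

Definition is_cycle (k : nat) : {pred chain k} :=
  match k with
  | 0 => predT
  | k'.+1 => fun c : chain k'.+1 => boundary c == 0
  end.

Fact is_cycle_submod_closed k : submod_closed (@is_cycle k).
Proof.
case: k => [|k]; split=> //; rewrite ?unfold_in/= ?linear0// => a c d.
by move=> /eqP c0 /eqP d0; apply/eqP; rewrite linearP /= c0 d0 scaler0 addr0.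
Qed.

HB.instance Definition _ k := GRing.isSubmodClosed.Build F (chain k)
  (@is_cycle k) (@is_cycle_submod_closed k).

Definition cycles (k : nat) := {c : chain k | is_cycle c}.

HB.instance Definition _ k := SubChoice.on (cycles k).
HB.instance Definition _ k := [SubChoice_isSubLmodule of cycles k by <:].

Definition is_boundary (k : nat) : {pred cycles k} :=
  fun z => `[< exists c : chain k.+1, boundary c = val z >].

Fact is_boundary_submod_closed k : submod_closed (@is_boundary k).
Proof.
split=> [|a z z'].
  by rewrite unfold_in; apply/asboolP; exists 0; rewrite !linear0.
rewrite !unfold_in => /asboolP[c zE] /asboolP[c' z'E].
by apply/asboolP; exists (a *: c + c'); rewrite linearP /= zE z'E.
Qed.

HB.instance Definition _ k := GRing.isSubmodClosed.Build F (cycles k)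
  (@is_boundary k) (@is_boundary_submod_closed k).

Definition homology (k : nat) : lmodType F := lquot (@is_boundary k).

End SingularHomology.

Section KleinBottle.
Variable R : realType.

(* a numFieldType K is equipped with its topology through the alias K^o *)
Definition circle : set R[i]^o := [set z | `|z| = 1].

Definition torus (n : nat) : topologicalType :=
  prod_topology (fun _ : 'I_n => circle).

Fact circle_opp_subproof (z : circle) : (- set_val z : R[i]^o) \in circle.
Proof. by apply/mem_set; rewrite /circle /= normrN; exact: set_mem (valP z). Qed.

Definition circle_opp (z : circle) : circle :=
  exist (fun w => w \in circle) _ (circle_opp_subproof z).

Fact circle_conj_subproof (z : circle) :
  ((set_val z : R[i])^* : R[i]^o) \in circle.
Proof.
by apply/mem_set; rewrite /circle /= norm_conjC; exact: set_mem (valP z).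
Qed.

Definition circle_conj (z : circle) : circle :=
  exist (fun w => w \in circle) _ (circle_conj_subproof z).

Definition klein_swap (n : nat) (z : torus n) : torus n :=
  fun i : 'I_n => if i.+1 == n then circle_opp (z i) else circle_conj (z i).

Lemma klein_swapK (n : nat) : involutive (@klein_swap n).
Proof.
move=> z; apply/funext => i; rewrite /klein_swap; apply: val_inj.
by case: (i.+1 == n); rewrite /= ?opprK// conjCK.
Qed.

(* as [klein_swap] is an involution, this is the equivalence relation that    *)
(* z ~ klein_swap z generates                                                 *)
Definition klein_rel (n : nat) : rel (torus n) :=
  fun z w => (w == z) || (w == klein_swap z).

Fact klein_rel_equiv (n : nat) : equiv_class_of (@klein_rel n).
Proof.
split=> [z|z w|w z v]; rewrite /klein_rel ?eqxx//.
  by rewrite [z == w]eq_sym -(inv_eq (@klein_swapK n)) [z == _]eq_sym.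
by move=> /orP[]/eqP-> /orP[]/eqP->; rewrite ?klein_swapK eqxx ?orbT.
Qed.

Canonical klein_equivRel (n : nat) := EquivRelPack (@klein_rel_equiv n).

Definition klein_bottle (n : nat) : topologicalType :=
  quotient_topology {eq_quot klein_equivRel n}.

End KleinBottle.

(* Main.v *)
Require Import Defs.
From HB Require Import structures.
From mathcomp Require Import all_boot all_order all_algebra.
From mathcomp Require Import complex freeg zify ring lra.
From mathcomp Require Import all_classical all_reals topology normedtype trigo.

(* The universal cover of K_n is R^n, and every singular simplex of K_n lifts   *)
(* to R^n, uniquely up to the group of deck transformations generated by the    *)
(* translations t_0, ..., t_{n-2} by a period along the first coordinates and   *)
(* by the glide reflection g. Hence the singular complex of K_n is C / N where  *)
(* C is that of R^n and N is generated by all x - t_i x and x - g x.            *)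
(*   Dividing by one generator u at a time, 1 - u is injective on the quotient  *)
(* C / N_j reached so far and has C / N_{j+1} as cokernel, so that H_k of the   *)
(* latter is an extension of ker (1 - u | H_{k-1} (C / N_j)) by                 *)
(* coker (1 - u | H_k (C / N_j)). A translation is homotopic to the identity    *)
(* and thus acts trivially on homology: C / N_j, the complex of                 *)
(* (S^1)^j x R^(n-j), has Betti numbers 'C(j, k). The reflection of all the     *)
(* translated coordinates conjugates t_j to its inverse, hence acts on H_k by   *)
(* (-1)^k, by induction on j; so does g, which is homotopic to this reflection. *)
(* Therefore 1 - g is 0 on H_k for k even, and an isomorphism for k odd.        *)

(** The plan above has an algebraic and a geometric half. Algebra: when [1 - g] is injective on
    [C / N], the sequence [0 -> C / N -> C / N -> C / N' -> 0] with first map [1 - g] computes the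
    homology of [C / N'] from the kernel and cokernel of [1 - g] on that of [C / N] ([wang0],
    [wangS]). For translations both are everything, and Pascal's rule yields the torus
    ([tower_dim]). The crux is that reflecting the translated coordinates acts by [(-1)^k] on [H_k]
    ([rho_acts]). Hence in the last step ([twisted_dim]) degree [k] receives [H_k] of the
    [(n-1)]-torus if [k] is even and [H_(k-1)] if [k] is odd, so each even torus group is counted in
    two consecutive degrees. Injectivity of [1 - g] at every stage reflects the freeness of the deck
    action on simplices: [shift_free] uses an explicit left inverse. Geometry: every singular
    simplex of the Klein bottle lifts ([klein_proj_surj]), and two lifts are congruent modulo the
    subcomplex [deck_sub] ([klein_proj_inj]). So [klein_chain] is onto with kernel [deck_sub], and
    [klein_homology_dim] transports the dimensions. *)

Set Implicit Arguments.
Unset Strict Implicit.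
Unset Printing Implicit Defensive.
Import Order.TTheory GRing.Theory Num.Theory.
Import numFieldNormedType.Exports.
Local Open Scope classical_set_scope.
Local Open Scope ring_scope.
Local Open Scope quotient_scope.

(** * Homology relative to a subcomplex *)

(* Equalities in abelian groups are decided by comparing integer coefficients. *)
Inductive zterm := ZVar of nat | ZAdd of zterm & zterm | ZOpp of zterm | ZZero.

Fixpoint zcoef (i : nat) (t : zterm) : int :=
  match t with
  | ZVar j => (i == j)%:Z
  | ZAdd u v => zcoef i u + zcoef i v
  | ZOpp u => - zcoef i u
  | ZZero => 0
  end.

Fixpoint zvars (t : zterm) : nat :=
  match t with
  | ZVar j => j.+1
  | ZAdd u v => maxn (zvars u) (zvars v)
  | ZOpp u => zvars u
  | ZZero => 0
  end.

Fixpoint zeval (V : zmodType) (e : seq V) (t : zterm) : V :=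
  match t with
  | ZVar j => e`_j
  | ZAdd u v => zeval e u + zeval e v
  | ZOpp u => - zeval e u
  | ZZero => 0
  end.

Lemma zevalE (V : zmodType) (e : seq V) t n : (zvars t <= n)%N ->
  zeval e t = \sum_(i < n) e`_i *~ zcoef i t.
Proof.
elim: t => [j|u IHu v IHv|u IHu|] /=.
- move=> jn; rewrite (bigD1 (Ordinal jn)) //= eqxx mulr1z big1 ?addr0 // => i.
  by rewrite -val_eqE /= => /negPf->.
- rewrite geq_max => /andP[/IHu-> /IHv->]; rewrite -big_split /=.
  by apply: eq_bigr => i _; rewrite mulrzDr.
- by move=> /IHu->; rewrite -sumrN; apply: eq_bigr => i _; rewrite mulrNz.
- by rewrite big1.
Qed.

Lemma zeval_eq (V : zmodType) (e : seq V) t u :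
  let n := maxn (zvars t) (zvars u) in
  all (fun i => zcoef i t == zcoef i u) (iota 0 n) -> zeval e t = zeval e u.
Proof.
move=> n /allP tu; rewrite (@zevalE _ _ t n) ?leq_maxl//.
rewrite (@zevalE _ _ u n) ?leq_maxr//; apply: eq_bigr => i _.
by rewrite (eqP (tu i _)) // mem_iota /=.
Qed.

Ltac zindex x l :=
  match l with
  | ?y :: _ => let _ := match constr:(tt) with _ => unify x y end in constr:(0%N)
  | _ :: ?l' => let n := zindex x l' in constr:(n.+1)
  end.

Ltac zadd x l :=
  match l with
  | _ => let n := zindex x l in l
  | _ => let l' := eval cbv [cat] in (l ++ [:: x]) in l'
  end.

Ltac zatoms t l :=
  lazymatch t with
  | 0%R => l
  | (?u + ?v)%R => let l := zatoms u l in zatoms v l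
  | (- ?u)%R => zatoms u l
  | _ => zadd t l
  end.

Ltac zquote t l :=
  lazymatch t with
  | 0%R => constr:(ZZero)
  | (?u + ?v)%R => let u := zquote u l in let v := zquote v l in constr:(ZAdd u v)
  | (- ?u)%R => let u := zquote u l in constr:(ZOpp u)
  | _ => let n := zindex t l in constr:(ZVar n)
  end.

Ltac zmod :=
  lazymatch goal with
  | |- @eq ?V ?t ?u =>
    let l := zatoms t (@nil V) in let l := zatoms u l in
    let t := zquote t l in let u := zquote u l in
    exact: (@zeval_eq _ l t u isT)
  end.

Definition submodule (F : nzRingType) (V : lmodType F) (S : V -> Prop) :=
  S 0 /\ forall a x y, S x -> S y -> S (a *: x + y).

Section Submodule.
Variables (F : nzRingType) (V : lmodType F) (S : V -> Prop).
Hypothesis S_sub : submodule S.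

Lemma submodule0 : S 0. Proof. by case: S_sub. Qed.

Lemma submoduleZ a x : S x -> S (a *: x).
Proof. by case: S_sub => S0 + Sx => /(_ a x 0 Sx S0); rewrite addr0. Qed.

Lemma submoduleD x y : S x -> S y -> S (x + y).
Proof. by case: S_sub => _ + Sx Sy => /(_ 1 x y Sx Sy); rewrite scale1r. Qed.

Lemma submoduleN x : S x -> S (- x).
Proof. by move=> /(submoduleZ (-1)); rewrite scaleN1r. Qed.

Lemma submoduleB x y : S x -> S y -> S (x - y).
Proof. by move=> Sx /submoduleN; exact: submoduleD. Qed.

Lemma submodule_sum (I : Type) (r : seq I) (P : pred I) (f : I -> V) :
  (forall i, P i -> S (f i)) -> S (\sum_(i <- r | P i) f i).
Proof. by move=> Sf; elim/big_rec: _ => [|i x /Sf]; [exact: submodule0|exact: submoduleD]. Qed.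

Lemma submodule_congr x y : S (x - y) -> S y -> S x.
Proof. by move=> Sxy /(submoduleD Sxy); rewrite subrK. Qed.

End Submodule.

(* [basis_mod Z B b] says that the quotient [Z / (B :&: Z)] has dimension [b]. *)
Definition basis_mod (F : nzRingType) (V : lmodType F) (Z B : V -> Prop) (b : nat) :=
  exists e : 'I_b -> V, [/\ forall i, Z (e i),
    forall a : 'I_b -> F, B (\sum_i a i *: e i) -> forall i, a i = 0 &
    forall z, Z z -> exists a : 'I_b -> F, B (z - \sum_i a i *: e i)].

Section BasisMod.
Variables (F : nzRingType) (V : lmodType F).
Implicit Types Z B : V -> Prop.

Lemma basis_mod_ext Z Z' B B' b :
  (forall z, Z z <-> Z' z) -> (forall z, Z z -> B z <-> B' z) ->
  submodule Z -> basis_mod Z B b -> basis_mod Z' B' b.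
Proof.
move=> ZZ' BB' subZ [e [Ze free_e span_e]].
have Zsum a : Z (\sum_i a i *: e i).
  by apply: submodule_sum => // i _; exact: submoduleZ.
exists e; split=> [i|a Ba|z Z'z].
- exact/ZZ'.
- by apply: free_e; apply/BB'.
- have Zz : Z z by apply/ZZ'.
  have [a Ba] := span_e z Zz; exists a; apply/BB' => //; exact: submoduleB.
Qed.

Lemma basis_mod0 Z B : (forall z, Z z -> B z) -> basis_mod Z B 0.
Proof.
move=> ZB; exists (fun=> 0); split=> [[]//|a _ []//|z Zz].
by exists (fun=> 0); rewrite big_ord0 subr0; exact: ZB.
Qed.

End BasisMod.

Section Complex.
Variables (F : fieldType) (C : nat -> lmodType F).
Variable d : forall k, {linear C k.+1 -> C k}.
Hypothesis dd : forall k (x : C k.+2), d k (d k.+1 x) = 0.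
Implicit Types N : forall k, C k -> Prop.

(* [cyc N] and [bnd N] are the preimages in [C] of the cycles and the boundaries *)
(* of the quotient [C / N], which is never formed. *)
Definition cyc N k : C k -> Prop :=
  match k with 0 => fun=> True | k'.+1 => fun c => N k' (d k' c) end.

Definition bnd N k (c : C k) := exists y n, N k n /\ c = d k y + n.
Arguments bnd : clear implicits.
Arguments cyc : clear implicits.

Definition subcomplex N :=
  (forall k, submodule (N k)) /\ (forall k x, N k.+1 x -> N k (d k x)).

Section Sub.
Variable N : forall k, C k -> Prop.
Arguments N : clear implicits.
Hypothesis N_sub : subcomplex N.

Lemma bnd_submodule k : submodule (bnd N k).
Proof.
have [Nm _] := N_sub.
split=> [|a x y [u [n [Nn ->]]] [v [m [Nm' ->]]]].
  by exists 0, 0; rewrite linear0 addr0; split=> //; exact: submodule0.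
exists (a *: u + v), (a *: n + m); split; first by case: (Nm k) => _; apply.
by rewrite linearP scalerDr addrACA.
Qed.

Lemma cyc_submodule k : submodule (cyc N k).
Proof.
have [Nm _] := N_sub; case: k => [//|k]; split=> /= [|a x y Nx Ny].
  by rewrite linear0; exact: submodule0.
by rewrite linearP; case: (Nm k) => _; apply.
Qed.

Lemma bnd_d k y : bnd N k (d k y).
Proof. by exists y, 0; rewrite addr0; split=> //; apply: submodule0; case: N_sub. Qed.

Lemma bnd_N k n : N k n -> bnd N k n.
Proof. by exists 0, n; rewrite linear0 add0r. Qed.

Lemma cyc_N k n : N k n -> cyc N k n.
Proof. by case: k n => [//|k] n; case: N_sub => _; apply. Qed.

Lemma cyc_d k y : cyc N k (d k y).
Proof. by case: k y => [//|k] y /=; rewrite dd; apply: submodule0; case: N_sub. Qed.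

Lemma cyc_bnd k c : bnd N k c -> cyc N k c.
Proof.
move=> [y [n [Nn ->]]]; apply: (submoduleD (cyc_submodule k)).
  exact: cyc_d.
exact: cyc_N.
Qed.

End Sub.

(** * The Wang exact sequence of a chain endomorphism *)

Section Wang.
Variables (N : forall k, C k -> Prop) (g : forall k, {linear C k -> C k}).
Arguments N : clear implicits.
Hypothesis N_sub : subcomplex N.
Hypothesis gd : forall k x, g k (d k x) = d k (g k.+1 x).
Hypothesis gN : forall k x, N k x -> N k (g k x).
Hypothesis g_free : forall k x, N k (x - g k x) -> N k x.

(** The preimage in [C] of the image of [1 - g] on [C / N]: dividing by it gives the coinvariants of
    [g] on [C / N]. *)
Definition wang_sub k (c : C k) := exists b, N k (c - (b - g k b)).

Lemma wang_sub_subcomplex : subcomplex wang_sub.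
Proof.
have [Nm Nd] := N_sub; split=> [k|k x [b Nb]].
  split=> [|a x y [b Nb] [c Nc]].
    by exists 0; rewrite linear0 !subr0; exact: submodule0.
  exists (a *: b + c); have := (Nm k).2 a _ _ Nb Nc.
  congr (N _ _); rewrite linearP !scalerBr. by zmod.
by exists (d k b); rewrite gd -!linearB; exact: Nd.
Qed.

Lemma wang_subW k x : N k x -> wang_sub x.
Proof. by exists 0; rewrite linear0 !subr0. Qed.

Lemma wang_sub1 k x : wang_sub (x - g k x).
Proof. by exists x; rewrite subrr; case: N_sub => Nm _; exact: submodule0. Qed.

(** [coker_bnd] and [ker_cyc] present the cokernel and the kernel of [1 - g] on the homology of
    [C / N], again through representatives in [C]. *)
Definition coker_bnd k (c : C k) := exists2 y, cyc N k y & bnd N k (c - (y - g k y)).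
Definition ker_cyc k (c : C k) := cyc N k c /\ bnd N k (c - g k c).

Lemma cyc_g k x : cyc N k x -> cyc N k (g k x).
Proof. by case: k x => [//|k] x /=; rewrite -gd; exact: gN. Qed.

Lemma cyc_free k x : cyc N k (x - g k x) -> cyc N k x.
Proof. by case: k x => [//|k] x /=; rewrite linearB -gd; exact: g_free. Qed.

Lemma wang_bnd k c : coker_bnd c -> bnd (@wang_sub) k c.
Proof.
move=> [y _ [u [n [Nn E]]]]; exists u, (n + (y - g k y)); split.
  by exists y; rewrite addrK.
by rewrite addrA -E subrK.
Qed.

(** The kernel term is absent in degree 0. Every chain is a cycle there, so the witness of
    [wang_sub] serves for [coker_bnd]. *)
Lemma wang0 a : basis_mod (cyc N 0) (@coker_bnd 0) a ->
  basis_mod (cyc (@wang_sub) 0) (bnd (@wang_sub) 0) a.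
Proof.
move=> [e [_ free_e span_e]]; exists e; split=> // [x [w [n [[b Nb] E]]]|z _].
  apply: free_e; exists b => //; exists w, (n - (b - g 0%N b)).
  by rewrite addrA -E.
by have [x /wang_bnd ?] := span_e z I; exists x.
Qed.

(** The connecting map of the long exact sequence sends [z] with [d z = u - g u] modulo [N] to the
    class of [u]. The basis joins the [e i], from the cokernel, to lifts [h i] of the [f i], from
    the kernel. *)
Lemma wangS k a b :
  basis_mod (cyc N k.+1) (@coker_bnd k.+1) a ->
  basis_mod (@ker_cyc k) (bnd N k) b ->
  basis_mod (cyc (@wang_sub) k.+1) (bnd (@wang_sub) k.+1) (a + b).
Proof.
have [Nm Nd] := N_sub; have [N'm N'd] := wang_sub_subcomplex.
have N'b := bnd_submodule wang_sub_subcomplex.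
move=> [e [cyc_e free_e span_e]] [f [ker_f free_f span_f]].
(* The connecting map is to send [h i] to [f i], hence this condition on the boundary of [h i]. *)
have /choice[h hP] : forall i, exists y, N k (f i - g k (f i) - d k y).
  move=> i; have [_ [y [n [Nn ->]]]] := ker_f i.
  by exists y; rewrite [d k y + n]addrC addrK.
pose E (i : 'I_(a + b)) := match fintype.split i with inl i => e i | inr i => h i end.
have sumE (x : 'I_(a + b) -> F) : \sum_i x i *: E i =
   \sum_i x (lshift b i) *: e i + \sum_i x (rshift a i) *: h i.
  rewrite big_split_ord /E; congr (_ + _); apply: eq_bigr => i _.
    by rewrite -[lshift b i]/(unsplit (inl i)) unsplitK.
  by rewrite -[rshift a i]/(unsplit (inr i)) unsplitK.
have dh (x : 'I_b -> F) : let s := \sum_i x i *: f i in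
  N k (s - g k s - d k (\sum_i x i *: h i)).
  rewrite /= !linear_sum /= -!big_split; apply: submodule_sum => // i _.
  by rewrite !linearZ /= -!scalerDr; apply: submoduleZ.
exists E; split=> [i|x|z].
- rewrite /E; case: fintype.split => j /=; first exact/wang_subW/cyc_e.
  by exists (f j); rewrite /= -opprB; exact: (submoduleN (Nm k)).
- rewrite sumE => -[w [n [[u Nu] Ex]]].
  set s := \sum_i x (rshift a i) *: f i.
  have cyc_xe : cyc N k.+1 (\sum_i x (lshift b i) *: e i).
    apply: (submodule_sum (cyc_submodule N_sub _)) => j _.
    exact: (submoduleZ (cyc_submodule N_sub _)).
  (* Applying [d] to the relation makes [s - d u] fixed by [g] modulo [N]; freeness puts it in [N],
     so [s] bounds. *)
  have f0 : bnd N k s.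
    apply: (submodule_congr (bnd_submodule N_sub k) _ (bnd_d N_sub u)).
    apply: bnd_N; apply: g_free.
    have -> : s - d k u - g k (s - d k u) =
      (s - g k s - d k (\sum_i x (rshift a i) *: h i)) +
      d k (n - (u - g _ u)) - d k (\sum_i x (lshift b i) *: e i).
      have Ed : d k n = d k (\sum_i x (lshift b i) *: e i) +
          d k (\sum_i x (rshift a i) *: h i).
        by rewrite -linearD Ex linearD /= dd add0r.
      by rewrite linearB /= [in RHS]linearB /= linearB /= Ed -gd; zmod.
    exact: (submoduleB (Nm k) (submoduleD (Nm k) (dh _) (Nd _ _ Nu)) cyc_xe).
  have x0 i : x (rshift a i) = 0 by exact: free_f f0 i.
  (* With the [h i] gone, [u] is itself a cycle, and it shows that the combination of the [e i]
     vanishes in the cokernel. *)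
  have x1 i : x (lshift b i) = 0.
    apply: (free_e (fun i => x (lshift b i))); exists u.
      apply: cyc_free; rewrite -[u - _](subKr n).
      apply: (submoduleB (cyc_submodule N_sub _)); last exact: cyc_N.
      have -> : n = \sum_i x (lshift b i) *: e i - d _ w.
        have -> : \sum_i x (lshift b i) *: e i = d _ w + n.
          by rewrite -Ex [X in _ + X]big1 ?addr0 // => j _; rewrite x0 scale0r.
        by rewrite addrC addKr.
      exact: (submoduleB (cyc_submodule N_sub _) cyc_xe (cyc_d N_sub w)).
    exists w, (n - (u - g k.+1 u)); split=> //.
    rewrite addrA -Ex [X in _ = _ + X - _]big1 ?addr0 // => j _.
    by rewrite x0 scale0r.
  by move=> i; rewrite -(splitK i); case: (fintype.split i) => j; rewrite /= ?x0 ?x1.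
- move=> [u Nu].
  have bnd_u : bnd N k (u - g k u).
    by exists z, (- (d k z - (u - g k u))); split; [exact: (submoduleN (Nm k))|zmod].
  have cyc_u : cyc N k u by apply: cyc_free; exact: cyc_bnd.
  have [y [v [n [Nn Ev]]]] := span_f u (conj cyc_u bnd_u).
  (* After this subtraction the boundary is [n - g n] modulo [N], hence in [N]: what remains is a
     cycle modulo [N]. *)
  have [x Bx] : exists x : 'I_a -> F,
      coker_bnd (z - \sum_i y i *: h i - (v - g _ v) - \sum_i x i *: e i).
    apply: span_e; rewrite /= !linearB /= -gd.
    have := submoduleD (Nm k) (submoduleD (Nm k) Nu (dh y))
      (submoduleB (Nm k) Nn (gN Nn)).
    have -> : n = u - \sum_i y i *: f i - d k v by rewrite Ev; zmod.
    by congr (N _ _); rewrite !linearB /=; zmod.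
  exists (fun i => match fintype.split i with inl i => x i | inr i => y i end).
  rewrite sumE.
  rewrite [X in _ - (X + _)](eq_bigr (fun i => x i *: e i)); last first.
    by move=> i _; rewrite -[lshift b i]/(unsplit (inl i)) unsplitK.
  rewrite [X in _ - (_ + X)](eq_bigr (fun i => y i *: h i)); last first.
    by move=> i _; rewrite -[rshift a i]/(unsplit (inr i)) unsplitK.
  have := submoduleD (N'b _) (wang_bnd Bx) (bnd_N (@wang_sub1 _ v)).
  by congr (bnd _ _ _); zmod.
Qed.
End Wang.
End Complex.
Arguments cyc {F C} d N k c.
Arguments bnd {F C} d N k c.

(** * Quotients by successive automorphisms *)

Section Tower.
Variables (F : fieldType) (C : nat -> lmodType F).
Variable d : forall k, {linear C k.+1 -> C k}.
Hypothesis dd : forall k (x : C k.+2), d k (d k.+1 x) = 0.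
Hypothesis F2 : 2%:R != 0 :> F.

Variable t : nat -> forall k, {linear C k -> C k}.
Hypothesis td : forall i k x, t i k (d k x) = d k (t i k.+1 x).
Hypothesis tC : forall i j k x, t i k (t j k x) = t j k (t i k x).

Fixpoint tower j : forall k, C k -> Prop :=
  if j is j'.+1 then wang_sub (tower j') (t j') else fun k x => x = 0.
Arguments tower : clear implicits.

Lemma tower_subcomplex j : subcomplex d (tower j).
Proof.
elim: j => [|j IHj]; last by apply: wang_sub_subcomplex => // k x; exact: td.
split=> [k|k x /= ->]; last by rewrite linear0.
by split=> //= a x y -> ->; rewrite scaler0 addr0.
Qed.

(** Generators suffice. Leaving [y] free covers maps that turn [t i] into its inverse, for which [y]
    is [- phi (t i x)]. *)
Lemma tower_stable j k k' (phi : {linear C k -> C k'}) :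
  (forall i x, (i < j)%N -> exists y, phi (x - t i k x) = y - t i k' y) ->
  forall x, tower j k x -> tower j k' (phi x).
Proof.
elim: j => [|j IHj] phit x /=; first by move=> ->; rewrite linear0.
move=> [b Nb]; have [y Ey] := phit j b (ltnSn j); exists y.
by rewrite -Ey -linearB; apply: IHj => // i z /ltnW ij; exact: phit.
Qed.

Lemma tower_commute j k k' (phi : {linear C k -> C k'}) :
  (forall i x, (i < j)%N -> phi (t i k x) = t i k' (phi x)) ->
  forall x, tower j k x -> tower j k' (phi x).
Proof.
move=> phit; apply: tower_stable => i x ij.
by exists (phi x); rewrite linearB /= phit.
Qed.

Definition homotopy (g : forall k, {linear C k -> C k})
    (P : forall k, {linear C k -> C k.+1}) :=
  (forall x, d 0 (P 0 x) = x - g 0 x) /\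
  (forall k x, d k.+1 (P k.+1 x) + P k (d k x) = x - g k.+1 x).

(** Commuting with the [t i], the homotopy descends to the quotient: [P (d z)] lies in the tower. *)
Lemma homotopy_bnd j g P k z : homotopy g P ->
  (forall i k x, (i < j)%N -> P k (t i k x) = t i k.+1 (P k x)) ->
  cyc d (tower j) k z -> bnd d (tower j) k (z - g k z).
Proof.
move=> [P0 PS] Pt; case: k z => [|k] z cyc_z.
  by rewrite -P0; apply: bnd_d => //; exact: tower_subcomplex.
exists (P k.+1 z), (P k (d k z)); split; last by rewrite PS.
by apply: tower_commute cyc_z => i x ij; exact: Pt.
Qed.


Variables (m : nat) (P : nat -> forall k, {linear C k -> C k.+1}).
Hypothesis P_homotopy : forall i, (i < m)%N -> homotopy (t i) (P i).
Hypothesis Pt : forall i j k x, (i < m)%N -> P i k (t j k x) = t j k.+1 (P i k x).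
Hypothesis t_free :
  forall i k x, (i < m)%N -> tower i k (x - t i k x) -> tower i k x.

Variable r : forall k, {linear C k -> C k}.
Hypothesis rd : forall k x, r k (d k x) = d k (r k.+1 x).
Hypothesis rK : forall k x, r k (r k x) = x.
Hypothesis trt : forall i k x, (i < m)%N -> t i k (r k (t i k x)) = r k x.

Variable aug : {linear C 0 -> F^o}.
Hypothesis aug_d : forall x, aug (d 0 x) = 0.
Hypothesis aug_r : forall x, aug (r 0 x) = aug x.
Hypothesis aug_acyclic : forall x, aug x = 0 -> exists y, x = d 0 y.
Hypothesis aug_onto : exists o, aug o = 1.
Hypothesis acyclic : forall k (x : C k.+1), d k x = 0 -> exists y, x = d k.+1 y.

Let bndm j k := bnd_submodule (tower_subcomplex j) k.

Let t_trivial j k z : (j < m)%N ->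
  cyc d (tower j) k z -> bnd d (tower j) k (z - t j k z).
Proof.
move=> jm; apply: (@homotopy_bnd _ _ (P j)); first exact: P_homotopy.
by move=> *; exact: Pt.
Qed.

(** The sign makes [rho] the identity on homology, at the price of anticommuting with [d]. *)
Definition rho k (x : C k) := (-1) ^+ k *: r k x.

Lemma rhoD k x y : rho (x + y : C k) = rho x + rho y.
Proof. by rewrite /rho linearD scalerDr. Qed.

Lemma rhoN k x : rho (- x : C k) = - rho x.
Proof. by rewrite /rho linearN scalerN. Qed.

Lemma rhoB k x y : rho (x - y : C k) = rho x - rho y.
Proof. by rewrite rhoD rhoN. Qed.

Lemma rhoK k x : rho (rho x : C k) = x.
Proof. by rewrite /rho linearZ /= scalerA -expr2 sqrr_sign scale1r rK. Qed.

Lemma rho_d k x : d k (rho x) = - rho (d k x).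
Proof. by rewrite /rho linearZ /= -rd exprS mulN1r scaleNr. Qed.

Lemma rho_t i k x : (i < m)%N -> t i k (rho (t i k x)) = rho x.
Proof. by move=> im; rewrite /rho linearZ /= trt. Qed.

Lemma r_tower j k x : (j <= m)%N -> tower j k x -> tower j k (r k x).
Proof.
move=> jm; apply: tower_stable => i y /leq_trans/(_ jm) im.
exists (- r k (t i k y)); rewrite linearN /= trt // linearB /=; zmod.
Qed.

Lemma rho_tower j k x : (j <= m)%N -> tower j k x -> tower j k (rho x).
Proof. by move=> jm /(r_tower jm); apply: submoduleZ; case: (tower_subcomplex j). Qed.

(* For a cycle [z] modulo [tower j.+1], [z - rho z] is homologous to a cycle [u] *)
(* modulo [tower j]. Then [rho u] is homologous to [u] by induction, but also to *)
(* [- u] since [rho] is an involution. *)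
Lemma rho_acts j k z : (j <= m)%N ->
  cyc d (tower j) k z -> bnd d (tower j) k (z - rho z).
Proof.
elim: j k z => [|j IHj] [|k] z jm cyc_z.
- have [y ->] : exists y, z - rho z = d 0 y.
    by apply: aug_acyclic; rewrite linearB /= /rho expr0 scale1r aug_r subrr.
  exact: (bnd_d (tower_subcomplex 0)).
- have [y ->] : exists y, z - rho z = d k.+1 y; last first.
    exact: (bnd_d (tower_subcomplex 0)).
  apply: acyclic; rewrite /= in cyc_z.
  by rewrite linearB /= rho_d cyc_z /rho linear0 scaler0 oppr0 subr0.
(* In degree 0 every chain is already a cycle at the previous stage. *)
- have [y [n [Nn ->]]] := IHj 0%N z (ltnW jm) I.
  by exists y, n; split=> //; exact: wang_subW.
have Nm := (tower_subcomplex j).1.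
have [b Nb] := cyc_z.
(* [b - t j b] is [d z] modulo the tower, hence a cycle, and by freeness [1 - t j] reflects
   cycles. *)
have cyc_b : cyc d (tower j) k b.
  apply: (cyc_free (td j) (fun k x => t_free jm)).
  have -> : b - t j k b = d k z - (d k z - (b - t j k b)) by zmod.
  apply: (submoduleB (cyc_submodule (tower_subcomplex j) k)).
    exact: (cyc_d dd (tower_subcomplex j)).
  exact: (cyc_N (tower_subcomplex j)).
have cyc_tb : cyc d (tower j) k (t j k b).
  apply: (cyc_g (td j)) => // k' x; apply: tower_commute => i ? _; exact: tC.
(* [b] is homologous to [t b], and [t b] to [rho (t b)]. Since [rho b = t (rho (t b))], the boundary
   of [z - rho z] is [(1 - t) (b - rho (t b))] modulo the tower, so that subtracting [(1 - t) y]
   leaves a cycle. *)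
have [y [n [Nn Ey]]] := submoduleD (bndm j k) (t_trivial jm cyc_b) (IHj k _ (ltnW jm) cyc_tb).
pose u := z - rho z - (y - t j k.+1 y).
have cyc_u : cyc d (tower j) k.+1 u.
  have Edy : d k y = b - rho (t j k b) - n.
    by have := congr1 (fun c => c - n) Ey; rewrite addrK => <-; zmod.
  have := submoduleD (Nm k) (submoduleD (Nm k) Nb (rho_tower (ltnW jm) Nb))
    (submoduleB (Nm k) Nn (tower_commute (fun i x _ => tC j i x) Nn)).
  rewrite /u /= !linearB /= rho_d -td Edy !linearB /= !rhoD !rhoN -[rho b](rho_t _ jm).
  by congr (tower _ _ _); zmod.
have [M'm _] := tower_subcomplex j.+1.
have N'_yt : tower j.+1 k.+1 (y - t j k.+1 y) by exact: (wang_sub1 _ (tower_subcomplex j)).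
have bnd_u : bnd d (tower j.+1) k.+1 (u - rho u).
  have [y' [n' [Nn' ->]]] := IHj k.+1 u (ltnW jm) cyc_u.
  by exists y', n'; split=> //; exact: wang_subW.
have := submoduleD (bndm j.+1 k.+1) bnd_u (bnd_N d
  (submoduleB (M'm _) N'_yt (rho_tower jm N'_yt))).
move=> /(submoduleZ (bndm _ _) 2%:R^-1); congr (bnd _ _ _ _).
have -> : u - rho u + (y - t j k.+1 y - rho (y - t j k.+1 y)) = (z - rho z) *+ 2.
  by rewrite /u !rhoB !rhoK mulr2n; zmod.
by rewrite -scaler_nat scalerA mulVf // scale1r.
Qed.

(** Each [t j] acts trivially on homology, so both terms of the Wang sequence are full homology
    groups of stage [j] and their dimensions add up by Pascal's rule. Stage 0 is acyclic. *)
Lemma tower_dim j k : (j <= m)%N ->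
  basis_mod (cyc d (tower j) k) (bnd d (tower j) k) 'C(j, k).
Proof.
elim: j k => [|j IHj] k jm.
  case: k => [|k]; last first.
    apply: basis_mod0 => z /acyclic[y ->]; exact: (bnd_d (tower_subcomplex 0)).
  have [o aug_o] := aug_onto; exists (fun=> o); split=> // [a|z _].
    move=> [y [n [/= -> E]]] i; have := congr1 aug E.
    rewrite (ord1 i) addr0 aug_d.
    by rewrite big_ord1 linearZ /= aug_o [_ *: _]mulr1.
  exists (fun=> aug z); rewrite big_ord1.
  have [y ->] : exists y, z - aug z *: o = d 0 y.
    by apply: aug_acyclic; rewrite linearB linearZ /= aug_o [_ *: _]mulr1 subrr.
  exact: (bnd_d (tower_subcomplex 0)).
have Nsub := tower_subcomplex j.
have tN k' x : tower j k' x -> tower j k' (t j k' x).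
  by apply: tower_commute => i ? _; exact: tC.
have coker k' : basis_mod (cyc d (tower j) k') (@coker_bnd _ _ d (tower j) (t j) k') 'C(j, k').
  apply: basis_mod_ext (IHj k' (ltnW jm)) => [//|z cz|]; last exact: cyc_submodule.
  split=> [bz|[y cy by_]].
    exists 0; first by apply: submodule0; exact: cyc_submodule.
    by rewrite linear0 !subr0.
  exact: (submodule_congr (bndm j k') by_ (t_trivial jm cy)).
case: k => [|k]; first by have := coker 0%N; rewrite !bin0; exact: wang0.
rewrite binS; apply: (wangS dd Nsub (td j) tN (fun k x => t_free jm)) => //.
apply: basis_mod_ext (IHj k (ltnW jm)) => [z|//|]; last exact: cyc_submodule.
by split=> [cz|[]//]; split=> //; exact: t_trivial.
Qed.

Variable s : forall k, {linear C k -> C k}.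
Variable Ps : forall k, {linear C k -> C k.+1}.
Hypothesis sd : forall k x, s k (d k x) = d k (s k.+1 x).
Hypothesis st : forall i k x, (i < m)%N -> s k (t i k x) = t i k (s k x).
Hypothesis Ps_homotopy : homotopy s Ps.
Hypothesis Pst : forall i k x, (i < m)%N -> Ps k (t i k x) = t i k.+1 (Ps k x).

Let g k : {linear C k -> C k} := s k \o r k.
Hypothesis g_free : forall k x, tower m k (x - g k x) -> tower m k x.

(** [z] is homologous to [(-1)^k r z] by [rho_acts], and [r z] to [s (r z)] by the homotopy [Ps]. *)
Lemma g_acts k z : cyc d (tower m) k z ->
  bnd d (tower m) k (z - (-1) ^+ k *: g k z).
Proof.
move=> cz; have := rho_acts (leqnn m) cz.
have crz : cyc d (tower m) k (r k z).
  by apply: (cyc_g rd) cz => k' x; exact: r_tower.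
have /(submoduleZ (bndm m k) ((-1) ^+ k)) := homotopy_bnd Ps_homotopy Pst crz.
rewrite scalerBr => B1 B2; have := submoduleD (bndm m k) B2 B1.
by congr (bnd _ _ _ _); rewrite /rho /=; zmod.
Qed.

(** On homology [1 - g] is 0 in even degrees and multiplication by 2, thus invertible, in odd ones.
    An even degree keeps only its cokernel term, an odd one only the kernel term from the degree
    below. *)
Lemma twisted_dim k :
  basis_mod (cyc d (wang_sub (tower m) g) k) (bnd d (wang_sub (tower m) g) k)
    (if odd k then 'C(m, k.-1) else 'C(m, k)).
Proof.
have Nsub := tower_subcomplex m.
have gN k' x : tower m k' x -> tower m k' (g k' x).
  move=> /(r_tower (leqnn m)) /=; apply: tower_commute => i y; exact: st.
have gd k' x : g k' (d k' x) = d k' (g k'.+1 x) by rewrite /= rd sd.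
have double k' z : odd k' -> cyc d (tower m) k' z -> bnd d (tower m) k' (z + g k' z).
  by move=> ok /g_acts; rewrite -signr_odd ok scaleN1r opprK.
have half k' z : bnd d (tower m) k' (z *+ 2) -> bnd d (tower m) k' z.
  move=> /(submoduleZ (bndm _ _) 2%:R^-1).
  by rewrite -scaler_nat scalerA mulVf // scale1r.
have coker_even k' : ~~ odd k' ->
    basis_mod (cyc d (tower m) k') (@coker_bnd _ _ d (tower m) g k') 'C(m, k').
  move=> ek; apply: basis_mod_ext (tower_dim k' (leqnn m)) => [//|z cz|]; last exact: cyc_submodule.
  split=> [bz|[y cy by_]].
    exists 0; first by apply: submodule0; exact: cyc_submodule.
    by rewrite linear0 !subr0.
  apply: (submodule_congr (bndm m k') by_).
  by have := g_acts cy; rewrite -signr_odd (negPf ek) scale1r.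
have coker_odd k' : odd k' ->
    basis_mod (cyc d (tower m) k') (@coker_bnd _ _ d (tower m) g k') 0.
  (* As [g z] is homologous to [- z], the class of [z] is [1 - g] of its half. *)
  move=> ok; apply: basis_mod0 => z cz; exists (2%:R^-1 *: z).
    by apply: submoduleZ => //; exact: cyc_submodule.
  apply: half; have := double _ _ ok cz; congr (bnd _ _ _ _).
  have Ez : (2%:R^-1 *: z) *+ 2 = z by rewrite -scaler_nat scalerA mulfV // scale1r.
  by rewrite !mulrnBl -[g k' _ *+ 2]linearMn Ez mulr2n; zmod.
have ker_even k' : ~~ odd k' ->
    basis_mod (@ker_cyc _ _ d (tower m) g k') (bnd d (tower m) k') 'C(m, k').
  move=> ek; apply: basis_mod_ext (tower_dim k' (leqnn m)) => [z|//|]; last exact: cyc_submodule.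
  split=> [cz|[]//]; split=> //.
  by have := g_acts cz; rewrite -signr_odd (negPf ek) scale1r.
have ker_odd k' : odd k' ->
    basis_mod (@ker_cyc _ _ d (tower m) g k') (bnd d (tower m) k') 0.
  (* [z] is homologous both to [g z] and to [- g z], so its double bounds. *)
  move=> ok; apply: basis_mod0 => z [cz bz]; apply: half.
  have := submoduleD (bndm m k') (double _ _ ok cz) bz.
  by congr (bnd _ _ _ _); rewrite mulr2n; zmod.
case: k => [|k]; first by apply: wang0; exact: coker_even.
have [ok|ek] := boolP (odd k) => /=; rewrite ?ok ?(negPf ek) /=.
  rewrite -['C(m, k.+1)]addn0; apply: (wangS dd Nsub gd gN g_free); last exact: ker_odd.
  by apply: coker_even; rewrite /= ok.
rewrite -['C(m, k)]add0n; apply: (wangS dd Nsub gd gN g_free); last exact: ker_even.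
exact: coker_odd.
Qed.

End Tower.
Arguments tower {F C} t j k x.

(** * Chain complexes of semisimplicial sets *)

Section AlternatingSums.
Variables (F : nzRingType) (V : lmodType F).
Implicit Types a b : nat -> nat -> V.

(** The cancellation behind [d d = 0]: the last row and the last column cancel each other, and
    induction does the rest. *)
Lemma alternating_face_face a n :
  (forall i j, (i <= j < n)%N -> a j.+1 i = a i j) ->
  \sum_(i < n.+1) \sum_(j < n) (-1) ^+ (i + j) *: a i j = 0.
Proof.
elim: n => [|n IHn] aE; first by rewrite big1 // => i _; rewrite big_ord0.
rewrite big_ord_recr /=; under eq_bigr do rewrite big_ord_recr /=.
rewrite big_split /= IHn ?add0r; last first.
  by move=> i j /andP[ij jn]; apply: aE; rewrite ij ltnW.
rewrite -big_split big1 //= => i _.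
rewrite aE ?leq_ord ?ltnSn // [(n.+1 + i)%N]addnC addnS exprS mulN1r scaleNr.
by rewrite subrr.
Qed.

Lemma alternating_prism a b n :
  (forall i j, (i <= j < n)%N -> a i j.+1 = b j i) ->
  (forall i j, (j < i <= n)%N -> a i.+1 j = b j i) ->
  (forall j, (j < n)%N -> a j.+1 j.+1 = a j.+1 j) ->
  \sum_(i < n.+2) \sum_(j < n.+1) (-1) ^+ (i + j) *: a i j +
  \sum_(j < n) \sum_(i < n.+1) (-1) ^+ (i + j) *: b j i = a 0 0 - a n.+1 n.
Proof.
elim: n => [|n IHn] aL aR aD.
  by rewrite big_ord0 addr0 2!big_ord_recl big_ord0 !big_ord1 /= expr0 expr1
    scale1r scaleN1r addr0.
have odd_sign p : (-1) ^+ (p + p.+1) = -1 :> F by rewrite -signr_odd addnS addnn oddS odd_double.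
have even_sign p : (-1) ^+ (p + p) = 1 :> F by rewrite -signr_odd addnn odd_double.
have col : \sum_(i < n.+2) (-1) ^+ (i + n.+1) *: a i n.+1 =
    - (\sum_(i < n.+1) (-1) ^+ (i + n) *: b n i) + a n.+1 n.+1.
  rewrite big_ord_recr /= even_sign scale1r -sumrN; congr (_ + _).
  apply: eq_bigr => i _; rewrite aL ?leq_ord ?ltnSn //.
  by rewrite addnS exprS mulN1r scaleNr.
have row : \sum_(j < n.+2) (-1) ^+ (n.+2 + j) *: a n.+2 j =
    - (\sum_(j < n) (-1) ^+ (n.+1 + j) *: b j n.+1) + b n n.+1 - a n.+2 n.+1.
  rewrite 2!big_ord_recr /= [(n.+2 + n.+1)%N]addnC odd_sign scaleN1r -sumrN.
  have -> : (-1) ^+ (n.+2 + n) = 1 :> F by rewrite -signr_odd oddD /= negbK addbb.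
  rewrite scale1r (aR n.+1) ?ltnSn ?leqnn //.
  congr (_ + _ + _); apply: eq_bigr => i _.
  rewrite aR; last by rewrite ltnS leqnn ltnW // ltnS ltnW.
  by rewrite addSn exprS mulN1r scaleNr.
have bcol : \sum_(i < n.+2) (-1) ^+ (i + n) *: b n i =
    \sum_(i < n.+1) (-1) ^+ (i + n) *: b n i - b n n.+1.
  by rewrite big_ord_recr /= addnC odd_sign scaleN1r.
have -> : \sum_(i < n.+3) \sum_(j < n.+2) (-1) ^+ (i + j) *: a i j =
    \sum_(i < n.+2) \sum_(j < n.+1) (-1) ^+ (i + j) *: a i j +
    \sum_(i < n.+2) (-1) ^+ (i + n.+1) *: a i n.+1 +
    \sum_(j < n.+2) (-1) ^+ (n.+2 + j) *: a n.+2 j.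
  rewrite big_ord_recr -big_split /=; congr (_ + _).
  by apply: eq_bigr => i _; rewrite big_ord_recr.
have -> : \sum_(j < n.+1) \sum_(i < n.+2) (-1) ^+ (i + j) *: b j i =
    \sum_(j < n) \sum_(i < n.+1) (-1) ^+ (i + j) *: b j i +
    \sum_(j < n) (-1) ^+ (n.+1 + j) *: b j n.+1 +
    \sum_(i < n.+2) (-1) ^+ (i + n) *: b n i.
  rewrite big_ord_recr -big_split /=; congr (_ + _).
  by apply: eq_bigr => i _; rewrite big_ord_recr.
rewrite row col bcol (aD n) //.
have IH : \sum_(i < n.+2) \sum_(j < n.+1) (-1) ^+ (i + j) *: a i j =
    a 0%N 0%N - a n.+1 n - \sum_(j < n) \sum_(i < n.+1) (-1) ^+ (i + j) *: b j i.
  rewrite -IHn ?addrK // => [i j /andP[ij jn]|i j /andP[ji jn]|j jn].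
  - by apply: aL; rewrite ij ltnW.
  - by apply: aR; rewrite ji leqW.
  - by apply: aD; exact: ltnW.
by rewrite IH; zmod.
Qed.
End AlternatingSums.

(** * Linear maps out of free modules *)

Section FreeModule.
Variable F : fieldType.

Lemma freegU_scale (K : choiceType) (c : F) (x : K) :
  << c *g x >> = c *: << x >> :> {freeg K / F}.
Proof. by apply/eqP/freeg_eqP => y; rewrite coeffZ !coeffU mul1r. Qed.

Lemma freeg_ind (K : choiceType) (S : {freeg K / F} -> Prop) :
  submodule S -> (forall x : K, S << x >>) -> forall c, S c.
Proof.
move=> S_sub Sx c; rewrite -[c]freeg_sumE; apply: submodule_sum => // x _.
by rewrite freegU_scale; exact: submoduleZ.
Qed.

Lemma freeg_ext (K : choiceType) (V : lmodType F)
    (f g : {linear {freeg K / F} -> V}) :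
  (forall x : K, f << x >> = g << x >>) -> f =1 g.
Proof.
move=> fg; apply: freeg_ind => //; split=> [|a x y fgx fgy].
  by rewrite !linear0.
by rewrite !linearP fgx fgy.
Qed.

Lemma fglift1 (K : choiceType) (V : lmodType F) (f : K -> V) (x : K) :
  fglift f << x >> = f x.
Proof. by rewrite liftU scale1r. Qed.

(** A named copy of [fglift], to carry the linear structure. *)
Definition freeg_lin (K : choiceType) (V : lmodType F) (f : K -> V) :
  {freeg K / F} -> V := fglift f.

HB.instance Definition _ (K : choiceType) (V : lmodType F) (f : K -> V) :=
  GRing.isLinear.Build F {freeg K / F} V _ (freeg_lin f) (fglift_linear f).

Lemma freeg_linE (K : choiceType) (V : lmodType F) (f : K -> V) (x : K) :
  freeg_lin f << x >> = f x.
Proof. exact: fglift1. Qed.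

Definition freeg_map (K K' : choiceType) (f : K -> K') :
  {linear {freeg K / F} -> {freeg K' / F}} :=
  freeg_lin (fun x => << f x >> : {freeg K' / F}).

Lemma freeg_mapE (K K' : choiceType) (f : K -> K') x :
  freeg_map f << x >> = << f x >>.
Proof. exact: freeg_linE. Qed.

Lemma freeg_map_comp (K K' K'' : choiceType) (f : K -> K') (g : K' -> K'')
  (x : {freeg K / F}) : freeg_map g (freeg_map f x) = freeg_map (g \o f) x.
Proof.
have := @freeg_ext _ _ (freeg_map g \o freeg_map f) (freeg_map (g \o f)) _ x.
by apply=> s; rewrite /= !freeg_mapE.
Qed.

Lemma freeg_map_id (K : choiceType) (f : K -> K) (x : {freeg K / F}) :
  f =1 id -> freeg_map f x = x.
Proof.
move=> fE; have := @freeg_ext _ _ (freeg_map f) idfun _ x.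
by apply=> s; rewrite /= !freeg_mapE fE.
Qed.

End FreeModule.

Section FreeComplex.
Variables (F : fieldType) (B : nat -> choiceType).
Variable face : nat -> forall k, B k.+1 -> B k.

Local Notation ch k := ({freeg (B k) / F} : lmodType F).

Definition free_d k : {linear ch k.+1 -> ch k} :=
  freeg_lin (fun s => \sum_(i < k.+2) (-1) ^+ i *: << face i s >> : ch k).

Lemma free_dE k s : free_d k << s >> = \sum_(i < k.+2) (-1) ^+ i *: << face i s >>.
Proof. exact: freeg_linE. Qed.

Lemma free_dd :
  (forall i j k (s : B k.+2), (i <= j < k.+2)%N ->
     face i (face j.+1 s) = face j (face i s)) ->
  forall k (x : ch k.+2), free_d k (free_d k.+1 x) = 0.
Proof.
move=> faceC k x.
have := @freeg_ext F _ _ (free_d k \o free_d k.+1) \0 _ x; apply=> {}s /=.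
rewrite free_dE linear_sum -[RHS](@alternating_face_face F _
  (fun i j => << face j (face i s) >>) k.+2) => [|i j ij]; last by rewrite faceC.
apply: eq_bigr => i _; rewrite linearZ /= free_dE scaler_sumr.
by apply: eq_bigr => j _; rewrite scalerA exprD.
Qed.

Lemma free_d_map k (f : B k -> B k) (f' : B k.+1 -> B k.+1) :
  (forall i s, (i < k.+2)%N -> face i (f' s) = f (face i s)) ->
  forall x : ch k.+1, freeg_map F f (free_d k x) = free_d k (freeg_map F f' x).
Proof.
move=> ff' x.
have := @freeg_ext F _ _ (freeg_map F f \o free_d k) (free_d k \o freeg_map F f') _ x.
apply=> s /=; rewrite freeg_mapE !free_dE linear_sum; apply: eq_bigr => i _.
by rewrite linearZ /= freeg_mapE ff'.
Qed.

Variable p : nat -> forall k, B k -> B k.+1.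

Definition prism k : {linear ch k -> ch k.+1} :=
  freeg_lin (fun s => \sum_(j < k.+1) (-1) ^+ j *: << p j s >> : ch k.+1).

Lemma prismE k s : prism k << s >> = \sum_(j < k.+1) (-1) ^+ j *: << p j s >>.
Proof. exact: freeg_linE. Qed.

Lemma prism_map k (f : B k -> B k) (f' : B k.+1 -> B k.+1) :
  (forall j s, p j (f s) = f' (p j s)) ->
  forall x : ch k, prism k (freeg_map F f x) = freeg_map F f' (prism k x).
Proof.
move=> ff' x.
have := @freeg_ext F _ _ (prism k \o freeg_map F f) (freeg_map F f' \o prism k) _ x.
apply=> s /=; rewrite freeg_mapE !prismE linear_sum; apply: eq_bigr => i _.
by rewrite linearZ /= freeg_mapE ff'.
Qed.

Variable h0 h1 : forall k, B k -> B k.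
Hypothesis pL : forall i j k (s : B k.+1), (i <= j < k.+1)%N ->
  face i (p j.+1 s) = p j (face i s).
Hypothesis pR : forall i j k (s : B k.+1), (j < i <= k.+1)%N ->
  face i.+1 (p j s) = p j (face i s).
Hypothesis pD : forall j k (s : B k), (j < k)%N ->
  face j.+1 (p j.+1 s) = face j.+1 (p j s).
Hypothesis p0 : forall k (s : B k), face 0 (p 0 s) = h0 s.
Hypothesis p1 : forall k (s : B k), face k.+1 (p k s) = h1 s.

Lemma prism_homotopy0 (x : ch 0) :
  free_d 0 (prism 0 x) = freeg_map F (@h0 0) x - freeg_map F (@h1 0) x.
Proof.
have := @freeg_ext F _ _ (free_d 0 \o prism 0) (freeg_map F (@h0 0) \- freeg_map F (@h1 0)) _ x.
apply=> s /=; rewrite !freeg_mapE prismE linear_sum big_ord1 linearZ /= free_dE.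
by rewrite scale1r big_ord_recr big_ord1 /= p0 p1 scale1r expr1 scaleN1r.
Qed.

Lemma prism_homotopyS k (x : ch k.+1) :
  free_d k.+1 (prism k.+1 x) + prism k (free_d k x) =
  freeg_map F (@h0 k.+1) x - freeg_map F (@h1 k.+1) x.
Proof.
have := @freeg_ext F _ _ ((free_d k.+1 \o prism k.+1) \+ (prism k \o free_d k))
  (freeg_map F (@h0 k.+1) \- freeg_map F (@h1 k.+1)) _ x.
apply=> s /=; rewrite !freeg_mapE -p0 -p1.
rewrite -(@alternating_prism F _ (fun i j => << face i (p j s) >>)
  (fun j i => << p j (face i s) >>) k.+1) => [|i j ij|i j ij|j jk].
- rewrite prismE free_dE !linear_sum [in RHS]exchange_big; congr (_ + _).
    apply: eq_bigr => j _; rewrite linearZ /= free_dE scaler_sumr.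
    by apply: eq_bigr => i _; rewrite scalerA addnC exprD.
  rewrite [in RHS]exchange_big; apply: eq_bigr => i _.
  rewrite linearZ /= prismE scaler_sumr.
  by apply: eq_bigr => j _; rewrite scalerA exprD.
- by rewrite pL.
- by rewrite pR.
- by rewrite pD.
Qed.

End FreeComplex.

(** * Singular simplices of R^n *)

Section RealContinuous.
Variables (R : realType) (X : topologicalType).
Implicit Types f g : X -> R.

Lemma ctsD f g : continuous f -> continuous g -> continuous (fun x => f x + g x).
Proof. by move=> fc gc x; apply: cvgD; [exact: fc|exact: gc]. Qed.

Lemma ctsM f g : continuous f -> continuous g -> continuous (fun x => f x * g x).
Proof. by move=> fc gc x; apply: cvgM; [exact: fc|exact: gc]. Qed.

Lemma cts_cst (c : R) : continuous (fun _ : X => c).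
Proof. by move=> x; exact: cvg_cst. Qed.

Lemma ctsN f : continuous f -> continuous (fun x => - f x).
Proof. by move=> fc x; apply: cvgN; exact: fc. Qed.

Lemma ctsB f g : continuous f -> continuous g -> continuous (fun x => f x - g x).
Proof. by move=> fc /ctsN; exact: ctsD. Qed.

Lemma ctsV f : continuous f -> (forall x, f x != 0) -> continuous (fun x => (f x)^-1).
Proof. by move=> fc f0 x; apply: cvgV; [exact: f0|exact: fc]. Qed.

Lemma cts_sum (I : Type) (r : seq I) (P : pred I) (f : I -> X -> R) :
  (forall i, P i -> continuous (f i)) -> continuous (fun x => \sum_(i <- r | P i) f i x).
Proof.
move=> fc; elim: r => [|i r IHr].
  by rewrite (_ : (fun _ => _) = fun=> 0); [exact: cts_cst|apply/funext => x; rewrite big_nil].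
have [Pi|nPi] := boolP (P i); last first.
  rewrite (_ : (fun _ => _) = fun x => \sum_(i <- r | P i) f i x) //.
  by apply/funext => x; rewrite big_cons (negPf nPi).
rewrite (_ : (fun _ => _) = fun x => f i x + \sum_(i <- r | P i) f i x).
  by apply: ctsD => //; exact: fc.
by apply/funext => x; rewrite big_cons Pi.
Qed.

End RealContinuous.

Lemma continuous_row (R : realType) (X : topologicalType) n (f : X -> 'rV[R]_n) :
  (forall j, continuous (fun x => f x 0 j)) -> continuous f.
Proof.
move=> fc x A [P fP PA]; apply: filterS PA _.
apply: filter_forall => i; apply: filter_forall => j.
by rewrite (ord1 i); apply: fc; have := fP 0 j.
Qed.

(** * Maps of simplices induced by maps of vertices *)

Section Push.
Variable R : realType.

Lemma simplexP k (t : simplex R k) :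
  (forall i, 0 <= set_val t 0 i) /\ \sum_i set_val t 0 i = 1.
Proof. by case: t => t tS; exact: set_mem tS. Qed.

Lemma simplex_coord_continuous k i : continuous (fun t : simplex R k => set_val t 0 i).
Proof.
move=> t; apply: (@continuous_comp _ _ _ (set_val : simplex R k -> 'rV[R]_k.+1) (fun x => x 0 i)).
  exact: (@initial_continuous (simplex R k) _ set_val).
exact: coord_continuous.
Qed.

Lemma simplex_continuous (X : topologicalType) k (f : X -> simplex R k) :
  (forall j, continuous (fun x => set_val (f x) 0 j)) -> continuous f.
Proof. by move=> fc; apply: continuous_comp_initial; exact: continuous_row. Qed.

(** The affine map sending vertex [i] to vertex [h i], in barycentric coordinates. Faces and
    degeneracies are of this form, which reduces their identities to index arithmetic. *)
Definition push_mx a b (h : 'I_a.+1 -> 'I_b.+1) (t : 'rV[R]_a.+1) : 'rV[R]_b.+1 :=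
  \row_j \sum_(i | h i == j) t 0 i.

Fact push_subproof a b (h : 'I_a.+1 -> 'I_b.+1) (t : simplex R a) :
  push_mx h (set_val t) \in simplex R b.
Proof.
have [t_ge0 sum_t] := simplexP t; apply/mem_set; split=> [j|].
  by rewrite mxE sumr_ge0.
rewrite -[RHS]sum_t [RHS](partition_big h predT) //=.
by apply: eq_bigr => j _; rewrite mxE.
Qed.

Definition push a b (h : 'I_a.+1 -> 'I_b.+1) (t : simplex R a) : simplex R b :=
  exist _ (push_mx h (set_val t)) (push_subproof h t).

Definition partial_sum a (U : pred 'I_a.+1) (t : simplex R a) : R :=
  \sum_(i | U i) set_val t 0 i.

Lemma partial_sum_continuous a U : continuous (@partial_sum a U).
Proof.
apply: cts_sum => i _; exact: simplex_coord_continuous.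
Qed.

Lemma partial_sum_push a b (h : 'I_a.+1 -> 'I_b.+1) U t :
  partial_sum U (push h t) = partial_sum (U \o h) t.
Proof.
rewrite /partial_sum [RHS](partition_big h U) //=; apply: eq_bigr => j Uj.
rewrite mxE; apply: eq_bigl => i.
by case: eqP => [->|]; rewrite ?Uj ?andbF.
Qed.

Lemma push_comp a b c (h : 'I_a.+1 -> 'I_b.+1) (h' : 'I_b.+1 -> 'I_c.+1) t :
  push h' (push h t) = push (h' \o h) t.
Proof.
apply: val_inj; apply/rowP => j; rewrite !mxE.
exact: (partial_sum_push h (fun i => h' i == j)).
Qed.

Lemma push_id a t : push (@id 'I_a.+1) t = t.
Proof. by apply: val_inj; apply/rowP => j; rewrite mxE big_pred1_eq. Qed.

Lemma push_continuous a b (h : 'I_a.+1 -> 'I_b.+1) : continuous (push h).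
Proof.
apply: simplex_continuous => j.
rewrite (_ : (fun _ => _) = partial_sum (fun i => h i == j)).
  exact: partial_sum_continuous.
by apply/funext => t; rewrite /= mxE.
Qed.

Lemma face_push k (i : 'I_k.+2) : @face R k i = push (fintype.lift i).
Proof.
apply/funext => t; apply: val_inj; apply/rowP => j; rewrite !mxE.
case: unliftP => [j' ->|->].
  by rewrite (eq_bigl (pred1 j')) ?big_pred1_eq // => l; rewrite (inj_eq lift_inj).
by rewrite big_pred0 // => l; rewrite eq_sym (negPf (neq_lift _ _)).
Qed.

End Push.

Lemma bump_unbump_lt i j l : (i <= j)%N -> unbump j.+1 (bump i l) = bump i (unbump j l).
Proof. rewrite /bump /unbump; lia. Qed.

Lemma unbump_bump_gt i j l : (j < i)%N -> unbump j (bump i.+1 l) = bump i (unbump j l).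
Proof. rewrite /bump /unbump; lia. Qed.

Section RealSimplices.
Variables (R : realType) (n : nat).

(* The singular simplices of R^n, given by their coordinate functions. *)
Definition real_simplex (k : nat) : choiceType :=
  ('I_n -> continuousType (simplex R k) R : choiceType).

Lemma real_simplexP k (s s' : real_simplex k) :
  (forall l t, s l t = s' l t) -> s = s'.
Proof. by move=> E; apply/funext => l; apply/continuousEP => t; exact: E. Qed.

Definition real_face (i k : nat) (s : real_simplex k.+1) : real_simplex k :=
  fun l => s l \o face (inord i).

Fact affine_subproof k (a c : R) (f : continuousType (simplex R k) R) :
  continuous (fun t => a * f t + c).
Proof.
apply: ctsD; last exact: cts_cst.
by apply: ctsM; [exact: cts_cst|exact: cts_fun].
Qed.

Definition affine (a c : 'I_n -> R) k (s : real_simplex k) : real_simplex k :=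
  fun l => mkcts (@affine_subproof k (a l) (c l) (s l)).

Lemma affine_face a c i k s : real_face i (affine a c s) = affine a c (@real_face i k s).
Proof. exact: real_simplexP. Qed.

(** The formula is [(1 - u) f + u (a f + c)] regrouped, with [u] the partial sum and [f] taken at
    [push h t]. *)
Fact sweep_subproof k k' (a c : R) (h : 'I_k'.+1 -> 'I_k.+1) (U : pred 'I_k'.+1)
    (f : continuousType (simplex R k) R) :
  continuous (fun t => (1 + (a - 1) * partial_sum U t) * f (push h t) + c * partial_sum U t).
Proof.
apply: ctsD; apply: ctsM.
- apply: ctsD; first exact: cts_cst.
  by apply: ctsM; [exact: cts_cst|exact: partial_sum_continuous].
- move=> t; apply: continuous_comp; [exact: push_continuous|exact: cts_fun].
- exact: cts_cst.
- exact: partial_sum_continuous.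
Qed.

(* The map [t |-> H (s (push h t), u)], where [u] is the total weight that [t] *)
(* gives to [U] and [H (-, u)] moves linearly from the identity to [affine a c]. *)
Definition sweep (a c : 'I_n -> R) k k' (h : 'I_k'.+1 -> 'I_k.+1) (U : pred 'I_k'.+1)
    (s : real_simplex k) : real_simplex k' :=
  fun l => mkcts (@sweep_subproof k k' (a l) (c l) h U (s l)).

Lemma sweep_face a c k k' (h : 'I_k'.+2 -> 'I_k.+1) U i s :
  real_face i (sweep a c h U s) =
  sweep a c (h \o fintype.lift (inord i)) (U \o fintype.lift (inord i)) s.
Proof.
apply: real_simplexP => l t.
by rewrite /real_face /= /mkcts face_push push_comp !partial_sum_push.
Qed.

Lemma face_sweep a c k k' (h : 'I_k'.+1 -> 'I_k.+1) U i s :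
  sweep a c h U (real_face i s) = sweep a c (fintype.lift (inord i) \o h) U s.
Proof.
by apply: real_simplexP => l t; rewrite /= /mkcts /real_face /= face_push push_comp.
Qed.

Lemma sweep_eq a c k k' (h h' : 'I_k'.+1 -> 'I_k.+1) (U U' : pred 'I_k'.+1) s :
  h =1 h' -> U =1 U' -> sweep a c h U s = sweep a c h' U' s.
Proof. by move=> /funext-> /funext->. Qed.

Definition degen (j k : nat) (i : 'I_k.+2) : 'I_k.+1 := inord (unbump j i).

(** Simplex [j] of the triangulated prism: vertices up to [j] lie at the end of the homotopy, later
    ones at its start. *)
Definition prism_simplex (a c : 'I_n -> R) (j k : nat) : real_simplex k -> real_simplex k.+1 :=
  sweep a c (@degen j k) (fun i => i <= j)%N.

Lemma degenE j k (i : 'I_k.+2) : (j <= k)%N -> degen j i = unbump j i :> nat.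
Proof. by move=> jk; rewrite inordK // /unbump; have := ltn_ord i; lia. Qed.

Variables a c : 'I_n -> R.

Lemma prism_face_lt i j k (s : real_simplex k.+1) : (i <= j < k.+1)%N ->
  real_face i (prism_simplex a c j.+1 s) = prism_simplex a c j (real_face i s).
Proof.
move=> /andP[ij jk]; rewrite /prism_simplex sweep_face face_sweep; apply: sweep_eq => l /=.
  apply: val_inj; rewrite /= !degenE /= ?inordK; try lia.
  by rewrite bump_unbump_lt //; lia.
by rewrite inordK /bump; lia.
Qed.

Lemma prism_face_gt i j k (s : real_simplex k.+1) : (j < i <= k.+1)%N ->
  real_face i.+1 (prism_simplex a c j s) = prism_simplex a c j (real_face i s).
Proof.
move=> /andP[ji ik]; rewrite /prism_simplex sweep_face face_sweep; apply: sweep_eq => l /=.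
  apply: val_inj; rewrite /= !degenE /= ?inordK; try lia.
  by rewrite unbump_bump_gt //; lia.
by rewrite inordK /bump; lia.
Qed.

Lemma prism_face_diag j k (s : real_simplex k) : (j < k)%N ->
  real_face j.+1 (prism_simplex a c j.+1 s) = real_face j.+1 (prism_simplex a c j s).
Proof.
move=> jk; rewrite /prism_simplex !sweep_face; apply: sweep_eq => l /=.
  by apply: val_inj; rewrite /= !degenE /= ?inordK /bump /unbump; lia.
by rewrite inordK /bump; lia.
Qed.

Lemma prism_face_first k (s : real_simplex k) : real_face 0 (prism_simplex a c 0 s) = s.
Proof.
rewrite sweep_face (@sweep_eq _ _ _ _ _ id _ pred0) => [|l|l] /=.
- apply: real_simplexP => l t; rewrite /= /mkcts /partial_sum big_pred0 // push_id.
  by rewrite !mulr0 !addr0 mul1r.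
- by apply: val_inj; rewrite /= !degenE //= inordK // /bump /unbump; lia.
- by rewrite inordK /bump; lia.
Qed.

Lemma prism_face_last k (s : real_simplex k) :
  real_face k.+1 (prism_simplex a c k s) = affine a c s.
Proof.
rewrite sweep_face (@sweep_eq _ _ _ _ _ id _ predT) => [|l|l] /=.
- apply: real_simplexP => l t; rewrite /= /mkcts /partial_sum.
  by have [_ ->] := simplexP t; rewrite push_id !mulr1 addrCA subrr addr0.
- apply: val_inj; rewrite /= !degenE //= inordK // /bump /unbump.
  by have := ltn_ord l; lia.
- by rewrite inordK /bump; have := ltn_ord l; lia.
Qed.

Lemma real_face_face i j k (s : real_simplex k.+2) : (i <= j < k.+2)%N ->
  real_face i (real_face j.+1 s) = real_face j (real_face i s).
Proof.
move=> /andP[ij jk]; apply: real_simplexP => l t.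
rewrite /real_face /= !face_push !push_comp; congr (s l (push _ t)).
apply/funext => q; apply: val_inj.
have ik : (i < k.+2)%N by lia.
by rewrite /= !inordK /bump; lia.
Qed.

End RealSimplices.

(** * The deck transformations of R^n over K_n *)

Section ShiftInverse.
Variables (F : fieldType) (K : choiceType) (G G' : K -> K) (w : K -> int).
Hypotheses (GK : cancel G G') (G'K : cancel G' G).
Hypothesis wG : forall s, w (G s) = w s + 1.

(* A left inverse of [1 - G], which sums over the points of the orbit of [s] *)
(* whose weight lies between 0 and that of [s]. *)
Definition shift_inverse_simplex (s : K) : {freeg K / F} :=
  match w s with
  | Posz m => - \sum_(e < m) << iter e.+1 G' s >>
  | Negz m => \sum_(e < m.+1) << iter e G s >>
  end.

Definition shift_inverse : {linear {freeg K / F} -> {freeg K / F}} :=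
  freeg_lin shift_inverse_simplex.

(** Passing from [s] to [G s] raises the weight by one, so the two truncated orbit sums differ
    exactly in the term [s]. *)
Lemma shift_inverseK x : shift_inverse (x - freeg_map F G x) = x.
Proof.
have := @freeg_ext F _ _ (shift_inverse \o (idfun \- freeg_map F G)) idfun _ x.
apply=> s /=; rewrite linearB /= freeg_mapE /shift_inverse !freeg_linE.
rewrite /shift_inverse_simplex wG.
have iterG e : iter e G (G s) = iter e.+1 G s by rewrite iterSr.
have iterG' e : iter e.+1 G' (G s) = iter e G' s by rewrite iterSr GK.
case: (w s) => [m|[|m]].
- have -> : (Posz m + 1)%R = Posz m.+1 by lia.
  rewrite big_ord_recl iterG' opprK addrC -addrA -sumrB.
  by rewrite big1 ?addr0 // => e _; rewrite iterG' subrr.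
- have -> : (Negz 0 + 1)%R = Posz 0 by lia.
  by rewrite big_ord1 big_ord0 oppr0 subr0.
- have -> : (Negz m.+1 + 1)%R = Negz m by lia.
  rewrite big_ord_recl -addrA -sumrB.
  by rewrite big1 ?addr0 // => e _; rewrite iterG subrr.
Qed.

Variable t : K -> K.
Hypothesis t_shift : forall s, G (t s) = t (G s) \/ t (G (t s)) = G s.
Hypothesis t_shift' : forall s, G' (t s) = t (G' s) \/ t (G' (t s)) = G' s.
Hypothesis w_t : forall s, w (t s) = w s.

(** [G] may conjugate [t] to its inverse, so only the symmetric form of being one [t]-step apart is
    preserved by [G] and [G']. *)
Let adjacent (s s' : K) := s' = t s \/ s = t s'.

Let adjacentP s s' : adjacent s s' -> exists y, << s >> - << s' >> = y - freeg_map F t y.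
Proof.
move=> [->|->]; first by exists << s >>; rewrite freeg_mapE.
by exists (- << s' >>); rewrite linearN /= freeg_mapE opprK addrC.
Qed.

Let adjacentG s s' : adjacent s s' -> adjacent (G s) (G s').
Proof.
by move=> [->|->]; rewrite /adjacent; [case: (t_shift s)|case: (t_shift s')] => ->; auto.
Qed.

Let adjacentG' s s' : adjacent s s' -> adjacent (G' s) (G' s').
Proof.
by move=> [->|->]; rewrite /adjacent; [case: (t_shift' s)|case: (t_shift' s')] => ->; auto.
Qed.

(** Since [s] and [t s] have equal weights, their orbit sums match term by term, with adjacent
    partners. The left inverse thus descends to quotients by images of [1 - t]. *)
Lemma shift_inverse_stable x : exists y,
  shift_inverse (x - freeg_map F t x) = y - freeg_map F t y.
Proof.
elim/(@freeg_ind F K): x => [|s].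
  split=> [|a x x' [y Ey] [y' Ey']]; first by exists 0; rewrite linear0 subrr linear0.
  exists (a *: y + y').
  have -> : a *: x + x' - freeg_map F t (a *: x + x') =
    a *: (x - freeg_map F t x) + (x' - freeg_map F t x').
    by rewrite linearP /= scalerBr; zmod.
  by rewrite [LHS]linearP Ey Ey' [in RHS]linearP /= scalerBr; zmod.
rewrite linearB /= freeg_mapE !freeg_linE /shift_inverse_simplex w_t.
have sum_adjacent m (f : nat -> K -> K) :
    (forall e s s', adjacent s s' -> adjacent (f e s) (f e s')) ->
  exists y, \sum_(e < m) << f e s >> - \sum_(e < m) << f e (t s) >> = y - freeg_map F t y.
  move=> fP; have /choice[y yP] e : exists y, << f e s >> - << f e (t s) >> = y - freeg_map F t y.
    by apply: adjacentP; apply: fP; left.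
  exists (\sum_(e < m) y e); rewrite [freeg_map _ _ _]linear_sum -!sumrB.
  by apply: eq_bigr => e _; rewrite yP.
have adjacent_iter f : (forall s s', adjacent s s' -> adjacent (f s) (f s')) ->
    forall e s s', adjacent s s' -> adjacent (iter e f s) (iter e f s').
  by move=> fP; elim=> [//|e IHe] s1 s2 /IHe; exact: fP.
case: (w s) => m; last exact: (sum_adjacent m.+1 (fun e => iter e G)) (adjacent_iter _ adjacentG).
have [y Ey] := sum_adjacent m (fun e => iter e.+1 G') (fun e => adjacent_iter _ adjacentG' e.+1).
exists (- y); rewrite [freeg_map _ _ _]linearN /=.
by transitivity (- (y - freeg_map F t y)); first rewrite -Ey; zmod.
Qed.

End ShiftInverse.

(** * Translations and glide reflection acting on the simplices of R^n *)

Section DeckGroup.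
Variables (R : realType) (m : nat) (T : R).
Hypothesis T_gt0 : 0 < T.

Local Notation n := m.+1.
Local Notation F := rat.
Local Notation ch k := ({freeg (real_simplex R n k) / F} : lmodType F).

Definition shift (j : nat) (c : R) (k : nat) (s : real_simplex R n k) :
  real_simplex R n k := affine (fun=> 1) (fun l => if l == j :> nat then c else 0) s.

Definition reflect (k : nat) (s : real_simplex R n k) : real_simplex R n k :=
  affine (fun l => if (l < m)%N then -1 else 1) (fun=> 0) s.

Definition glide (k : nat) (s : real_simplex R n k) : real_simplex R n k :=
  shift m (T / 2%:R) (reflect s).

Definition glide_inv (k : nat) (s : real_simplex R n k) : real_simplex R n k :=
  reflect (shift m (- (T / 2%:R)) s).

Lemma shiftE j c k (s : real_simplex R n k) l t :
  shift j c s l t = s l t + if l == j :> nat then c else 0.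
Proof. by rewrite /shift /= /mkcts mul1r. Qed.

Lemma reflectE k (s : real_simplex R n k) l t :
  reflect s l t = if (l < m)%N then - s l t else s l t.
Proof. by rewrite /reflect /= /mkcts addr0; case: ifP => _; rewrite ?mulN1r ?mul1r. Qed.

Let simplexE := (shiftE, reflectE).

Lemma shiftC i j c c' k (s : real_simplex R n k) :
  shift i c (shift j c' s) = shift j c' (shift i c s).
Proof. by apply: real_simplexP => l t; rewrite !simplexE addrAC. Qed.

Lemma shiftK j c k : cancel (@shift j c k) (@shift j (- c) k).
Proof. by move=> s; apply: real_simplexP => l t; rewrite !simplexE; case: ifP; lra. Qed.

Lemma shiftNK j c k : cancel (@shift j (- c) k) (@shift j c k).
Proof. by move=> s; apply: real_simplexP => l t; rewrite !simplexE; case: ifP; lra. Qed.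

Lemma reflectK k : involutive (@reflect k).
Proof.
move=> s; apply: real_simplexP => l t; rewrite !simplexE; case: (l < m)%N => //.
by rewrite opprK.
Qed.

Lemma shift_reflect i k (s : real_simplex R n k) c : (i < m)%N ->
  shift i c (reflect (shift i c s)) = reflect s.
Proof.
move=> im; apply: real_simplexP => l t; rewrite !simplexE.
by case: eqP => [->|_]; [rewrite im|case: (l < m)%N]; lra.
Qed.

Lemma glideK k : cancel (@glide k) (@glide_inv k).
Proof. by move=> s; rewrite /glide /glide_inv shiftK reflectK. Qed.

Lemma glide_invK k : cancel (@glide_inv k) (@glide k).
Proof. by move=> s; rewrite /glide /glide_inv reflectK shiftNK. Qed.

Fact base_subproof k : (\row_j (j == 0)%:R : 'rV[R]_k.+1) \in simplex R k.
Proof.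
apply/mem_set; split=> [j|]; first by rewrite mxE ler0n.
rewrite (bigD1 ord0) //= mxE eqxx big1 ?addr0 // => j /negPf j0.
by rewrite mxE j0.
Qed.

Definition base (k : nat) : simplex R k :=
  exist (fun t => t \in simplex R k) _ (base_subproof k).

(** The position of one vertex along coordinate [j], in whole units of [p]. It tells [shift_inverse]
    where to truncate the orbit sums of a map that moves this coordinate by [p]. *)
Definition weight (j : nat) (p : R) (k : nat) (s : real_simplex R n k) : int :=
  Num.floor (s (inord j) (base k) / p).

Lemma weight_shift j p k (s : real_simplex R n k) : (j < n)%N -> p != 0 ->
  weight j p (shift j p s) = weight j p s + 1.
Proof.
move=> jn p0; rewrite /weight shiftE inordK // eqxx mulrDl divff //.
by rewrite floorDrz // Num.Theory.floor1.
Qed.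

Lemma weight_shift_neq i j p c k (s : real_simplex R n k) : (j < n)%N -> i != j ->
  weight j p (shift i c s) = weight j p s.
Proof. by move=> jn ij; rewrite /weight shiftE inordK // eq_sym (negPf ij) addr0. Qed.

Lemma weight_reflect p k (s : real_simplex R n k) : weight m p (reflect s) = weight m p s.
Proof. by rewrite /weight reflectE inordK // ltnn. Qed.

Local Notation d := (free_d F (@real_face R n)).
Definition translation (j : nat) (k : nat) : {linear ch k -> ch k} :=
  freeg_map F (@shift j T k).
Definition reflection (k : nat) : {linear ch k -> ch k} := freeg_map F (@reflect k).
Definition half_translation (k : nat) : {linear ch k -> ch k} :=
  freeg_map F (@shift m (T / 2%:R) k).
Definition glide_reflection (k : nat) : {linear ch k -> ch k} :=
  half_translation k \o reflection k.

Lemma real_dd k (x : ch k.+2) : d k (d k.+1 x) = 0.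
Proof. by apply: free_dd => *; exact: real_face_face. Qed.

Lemma affine_d a c k (x : ch k.+1) :
  freeg_map F (@affine R n a c k) (d k x) = d k (freeg_map F (@affine R n a c k.+1) x).
Proof. by apply: free_d_map => i s ik; rewrite affine_face. Qed.

(** Straight-line homotopies. Factor 0 gives the contraction of R^n, factor 1 the homotopies of
    translations. *)
Lemma affine_homotopy a c :
  homotopy d (fun k => freeg_map F (@affine R n a c k))
    (prism F (@prism_simplex R n a c)).
Proof.
split=> [x|k x].
  rewrite (prism_homotopy0 (h0 := fun k => id) (@prism_face_first R n a c)
    (@prism_face_last R n a c)).
  by rewrite freeg_map_id.
rewrite (prism_homotopyS (h0 := fun k => id) (@prism_face_lt R n a c)
  (@prism_face_gt R n a c) (@prism_face_diag R n a c)
  (@prism_face_first R n a c) (@prism_face_last R n a c)).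
by rewrite freeg_map_id.
Qed.

(** The displacement of a translation does not depend on the point. The straight-line homotopy to a
    reflection lacks this property, whence the detour through [rho_acts]. *)
Lemma prism_shift c i c' k (x : ch k) :
  prism F (@prism_simplex R n (fun=> 1) c) k (freeg_map F (@shift i c' k) x) =
  freeg_map F (@shift i c' k.+1) (prism F (@prism_simplex R n (fun=> 1) c) k x).
Proof.
apply: prism_map => j s; apply: real_simplexP => l t.
rewrite shiftE /prism_simplex /sweep /shift /affine /= /mkcts /=. ring.
Qed.


Definition augmentation (k : nat) : {linear ch k -> F^o} :=
  freeg_lin (fun=> 1 : F^o).

Lemma augmentationE k s : augmentation k << s >> = 1.
Proof. exact: freeg_linE. Qed.

Fact zero_simplex_subproof k : continuous (fun _ : simplex R k => 0 : R).
Proof. exact: cts_cst. Qed.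

Definition zero_simplex (k : nat) : real_simplex R n k :=
  fun=> mkcts (@zero_simplex_subproof k).

Lemma affine0 k (s : real_simplex R n k) : affine (fun=> 0) (fun=> 0) s = zero_simplex k.
Proof. by apply: real_simplexP => l t; rewrite /= /mkcts mul0r addr0. Qed.

Lemma map_affine0 k (x : ch k) :
  freeg_map F (@affine R n (fun=> 0) (fun=> 0) k) x = augmentation k x *: << zero_simplex k >>.
Proof.
move: x; apply: (@freeg_ind F (real_simplex R n k)) => [|s].
  split=> [|a x y Ex Ey]; first by rewrite !linear0 scale0r.
  by rewrite !linearP /= Ex Ey scalerDl -scalerA.
by rewrite freeg_mapE affine0 augmentationE scale1r.
Qed.

Lemma sign_sum k : \sum_(i < k) (-1) ^+ i = (odd k)%:R :> F.
Proof.
elim: k => [|k IHk]; first by rewrite big_ord0.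
by rewrite big_ord_recr /= IHk -signr_odd; case: (odd k); rewrite /= ?subrr ?add0r.
Qed.

Lemma d_zero_simplex k :
  d k << zero_simplex k.+1 >> = if odd k then << zero_simplex k >> else 0.
Proof.
have -> : (if odd k then << zero_simplex k >> else 0 : ch k) =
    (odd k.+2)%:R *: << zero_simplex k >>.
  by rewrite /= negbK; case: (odd k); rewrite ?scale1r ?scale0r.
rewrite -sign_sum scaler_suml free_dE; apply: eq_bigr => i _; congr (_ *: << _ >>).
exact: real_simplexP.
Qed.

Lemma augmentation_d (x : ch 1) : augmentation 0 (d 0 x) = 0.
Proof.
have := @freeg_ext F _ _ (augmentation 0 \o d 0) \0 _ x; apply=> s /=.
rewrite free_dE linear_sum /= 2!big_ord_recl big_ord0 !linearZ /=.
by rewrite !augmentationE expr0 expr1 scale1r scaleN1r addr0 subrr.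
Qed.

Lemma augmentation_acyclic (x : ch 0) : augmentation 0 x = 0 -> exists y, x = d 0 y.
Proof.
move=> x0; have [/(_ x) H _] := affine_homotopy (fun=> 0) (fun=> 0).
by move: H; rewrite map_affine0 x0 scale0r subr0 => <-; eexists.
Qed.

(** Contraction makes [x] homologous to a multiple of a constant simplex. For [k] even that simplex
    bounds; for [k] odd its boundary is the constant simplex below, so for a cycle the multiple is
    0. *)
Lemma real_acyclic k (x : ch k.+1) : d k x = 0 -> exists y, x = d k.+1 y.
Proof.
move=> dx0; have [_ /(_ k x)] := affine_homotopy (fun=> 0) (fun=> 0).
rewrite dx0 linear0 addr0 map_affine0 => E.
suff [y Ey] : exists y, augmentation k.+1 x *: << zero_simplex k.+1 >> = d k.+1 y.
  exists (prism F (@prism_simplex R n (fun=> 0) (fun=> 0)) k.+1 x + y).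
  by rewrite linearD /= -Ey E subrK.
have [ok|ek] := boolP (odd k); last first.
  exists (augmentation k.+1 x *: << zero_simplex k.+2 >>).
  by rewrite linearZ /= d_zero_simplex /= ek.
have /eqP : d k (freeg_map F (@affine R n (fun=> 0) (fun=> 0) k.+1) x) = 0.
  by rewrite -affine_d dx0 linear0.
rewrite map_affine0 linearZ /= d_zero_simplex ok -freegU_scale freegU_eq0 => /eqP->.
by exists 0; rewrite scale0r linear0.
Qed.

Local Notation tower_T := (tower translation).
Definition deck_sub := wang_sub (tower_T m) glide_reflection.

Lemma translationC i j k x :
  translation i k (translation j k x) = translation j k (translation i k x).
Proof. by rewrite !freeg_map_comp; congr (freeg_map _ _ _); apply/funext => s; exact: shiftC. Qed.

Lemma glide_reflectionE k x : glide_reflection k x = freeg_map F (@glide k) x.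
Proof. exact: freeg_map_comp. Qed.

(** The left inverse of [1 - G] preserves the tower, hence recovers [x] inside it from [x - G x].
    This is the injectivity that every Wang step requires. *)
Lemma shift_free (G G' : forall k, real_simplex R n k -> real_simplex R n k)
    (w : forall k, real_simplex R n k -> int) j k (x : ch k) :
  cancel (@G k) (@G' k) -> cancel (@G' k) (@G k) ->
  (forall s, w k (G k s) = w k s + 1) ->
  (forall i s, (i < j)%N -> G k (shift i T s) = shift i T (G k s) \/
     shift i T (G k (shift i T s)) = G k s) ->
  (forall i s, (i < j)%N -> G' k (shift i T s) = shift i T (G' k s) \/
     shift i T (G' k (shift i T s)) = G' k s) ->
  (forall i s, (i < j)%N -> w k (shift i T s) = w k s) ->
  tower_T j k (x - freeg_map F (G k) x) -> tower_T j k x.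
Proof.
move=> GK G'K wG tG tG' wt Nx; rewrite -(shift_inverseK GK wG x).
apply: tower_stable Nx => i y ij.
by apply: shift_inverse_stable => s; [exact: tG|exact: tG'|exact: wt].
Qed.

Lemma deck_subcomplex : subcomplex d deck_sub.
Proof.
apply: wang_sub_subcomplex => [|k x].
  by apply: tower_subcomplex => *; exact: affine_d.
by rewrite /= !affine_d.
Qed.

Lemma deck_dim k :
  basis_mod (cyc d deck_sub k) (bnd d deck_sub k)
    (if odd k then 'C(m, k.-1) else 'C(m, k)).
Proof.
have T0 : T != 0 by rewrite gt_eqF.
apply: (@twisted_dim F _ d real_dd _ translation _ translationC m
  (fun j => prism F (@prism_simplex R n (fun=> 1) (fun l => if l == j :> nat then T else 0)))
  _ _ _ reflection _ _ _ (augmentation 0) _ _ _ _ _ half_translation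
  (prism F (@prism_simplex R n (fun=> 1) (fun l => if l == m :> nat then T / 2%:R else 0)))).
- by [].
- move=> *; exact: affine_d.
- move=> *; exact: affine_homotopy.
- move=> *; exact: prism_shift.
(* Weight along coordinate [i]: the shifts already divided out leave it fixed. *)
- move=> i k' x im; apply: (@shift_free (@shift i T) (@shift i (- T)) (@weight i T)).
  + exact: shiftK.
  + exact: shiftNK.
  + by move=> s; apply: weight_shift; rewrite ?ltnS 1?ltnW.
  + by left; exact: shiftC.
  + by left; exact: shiftC.
  + by move=> j s ji; apply: weight_shift_neq; rewrite ?ltnS 1?ltnW // ltn_eqF.
- move=> *; exact: affine_d.
- by move=> k' x; rewrite freeg_map_comp freeg_map_id // => s; exact: reflectK.
- move=> i k' x im; rewrite !freeg_map_comp; congr (freeg_map _ _ _).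
  by apply/funext => s; exact: shift_reflect.
- exact: augmentation_d.
- move=> x; have := @freeg_ext F _ _ (augmentation 0 \o reflection 0) (augmentation 0) _ x.
  by apply=> s; rewrite /= freeg_mapE !augmentationE.
- exact: augmentation_acyclic.
- by exists << zero_simplex 0 >>; exact: augmentationE.
- exact: real_acyclic.
- move=> *; exact: affine_d.
- move=> i k' x im; rewrite !freeg_map_comp; congr (freeg_map _ _ _).
  by apply/funext => s; exact: shiftC.
- exact: affine_homotopy.
- by move=> *; exact: prism_shift.
(* The glide moves the last coordinate by [T / 2], which serves as the unit of weight; all the
   shifts divided out fix that coordinate. *)
- move=> k' x; rewrite glide_reflectionE.
  have T2 : T / 2%:R != 0 by rewrite gt_eqF // divr_gt0.
  apply: (@shift_free glide glide_inv (@weight m (T / 2%:R))).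
  + exact: glideK.
  + exact: glide_invK.
  + by move=> s; rewrite weight_shift ?ltnS // weight_reflect.
  + by move=> i s im; right; rewrite /glide shiftC shift_reflect.
  + by move=> i s im; right; rewrite /glide_inv [shift m _ (shift i _ _)]shiftC shift_reflect.
  + by move=> i s im; apply: weight_shift_neq; rewrite ?ltnS // ltn_eqF.
Qed.

End DeckGroup.
Arguments deck_sub {R m} T k c.

(** * Lifting functions from a simplex to the circle *)

Section Simplex.
Variable R : realType.

Lemma simplex_compact k : compact (simplex R k).
Proof.
apply: (@subclosed_compact _ _ [set v : 'rV[R]_k.+1 | forall i, v ord0 i \in `[0, 1]]).
- rewrite (_ : simplex R k = (\bigcap_(i in [set: 'I_k.+1])
      ((fun t : 'rV[R]_k.+1 => t 0 i) @^-1` [set x | 0 <= x])) `&`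
      ((fun t : 'rV[R]_k.+1 => \sum_i t 0 i) @^-1` [set x | x = 1])); last first.
    by apply/seteqP; split=> t [t_ge0 sum_t]; split=> // i; [move=> _|]; exact: t_ge0.
  apply: closedI.
    apply: closed_bigI => i _; apply: preimage_closed; last exact: closed_ge.
    by move=> t _; exact: coord_continuous.
  apply: preimage_closed; last exact: closed_eq.
  by move=> t _; apply: cts_sum => i _; exact: coord_continuous.
- apply: (@rV_compact R _ (fun=> `[0 : R, 1]%classic)).
  by move=> _; exact: segment_compact.
- move=> t [t_ge0 sum_t] i; rewrite /= in_itv /= t_ge0 -sum_t (bigD1 i) //=.
  by rewrite lerDl sumr_ge0.
Qed.

Lemma simplex_unif_continuous k (f : simplex R k -> R) (e : R) :
  continuous f -> 0 < e -> exists2 d, 0 < d &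
  forall s t : simplex R k,
    (forall i, `|set_val s 0 i - set_val t 0 i| < d) -> `|f s - f t| < e.
Proof.
move=> fc e0.
have /compact_near_coveringP/(_ _ (0 : R)^'+ (fun d (x : 'rV[R]_k.+1) =>
  forall s t : simplex R k, set_val s = x ->
   (forall i, `|set_val s 0 i - set_val t 0 i| < d) -> `|f s - f t| < e)) := @simplex_compact k.
move=> /(_ _)[].
  move=> x Sx; pose s0 : simplex R k := exist (fun t => t \in simplex R k) x (mem_set Sx).
  have : nbhs s0 (f @^-1` ball (f s0) (e / 2%:R)).
    by apply: fc; apply: nbhsx_ballx; rewrite divr_gt0.
  rewrite nbhsE => -[U [[A oA AU] Us0] Uf].
  have : nbhs x A by apply: open_nbhs_nbhs; split=> //; rewrite -AU in Us0.
  move=> /nbhs_ballP[r /= r0 rA].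
  (* One half of the radius absorbs the distance from [x] to [s], the other that from [s] to [t]. *)
  have r2 : 0 < r / 2%:R by rewrite divr_gt0.
  exists (ball x (r / 2%:R), [set d | 0 < d < r / 2%:R]) => /=.
    split; first exact: nbhsx_ballx.
    exists (r / 2%:R) => //= d; rewrite /ball /= sub0r normrN => dr d0.
    by rewrite d0 (le_lt_trans (ler_norm _) dr).
  move=> [x' d] /= [[_ xx'] /andP[d0 dr]] s t sx' st.
  have fball (u : simplex R k) :
      (forall i, `|x 0 i - set_val u 0 i| < r) -> `|f s0 - f u| < e / 2%:R.
    move=> xu; apply: Uf; rewrite -AU; apply: rA; split=> // i j.
    by rewrite (ord1 i); exact: xu.
  have xs i : `|x 0 i - set_val s 0 i| < r / 2%:R by rewrite sx'; exact: xx'.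
  have fs : `|f s0 - f s| < e / 2%:R.
    by apply: fball => i; apply: lt_trans (xs i) _; lra.
  have ft : `|f s0 - f t| < e / 2%:R.
    apply: fball => i; have := ler_distD (set_val s 0 i) (x 0 i) (set_val t 0 i).
    have := xs i; have := st i; lra.
  have := ler_distD (f s0) (f s) (f t); rewrite [`|f s - f s0|]distrC; lra.
move=> d /= d0 dP; exists (d / 2%:R); first by rewrite divr_gt0.
move=> s t st; apply: (dP (d / 2%:R)) st => //=.
- by rewrite /ball /= sub0r normrN gtr0_norm ?divr_gt0 //; lra.
- by rewrite divr_gt0.
- exact: set_mem (valP s).
Qed.

Definition star_time (j N : nat) : R := (minn j N)%:R / N%:R.

Fact star_subproof k (j N : nat) (t : simplex R k) :
  ((1 - star_time j N) *: set_val (base R k) + star_time j N *: set_val t : 'rV[R]_k.+1)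
    \in simplex R k.
Proof.
have /andP[c0 c1] : 0 <= star_time j N <= 1.
  rewrite /star_time divr_ge0 //=; case: N => [|N]; first by rewrite invr0 mulr0 ler01.
  by rewrite ler_pdivrMr ?ltr0n // mul1r ler_nat geq_minr.
have [b0 b1] := simplexP (base R k); have [t0 t1] := simplexP t.
apply/mem_set; split=> [i|].
  by rewrite !mxE addr_ge0 // mulr_ge0 // subr_ge0.
under eq_bigr do rewrite !mxE.
rewrite big_split -!mulr_sumr /= t1.
have -> : \sum_(i < k.+1) (i == 0)%:R = 1 :> R.
  by rewrite -[RHS]b1; apply: eq_bigr => i _; rewrite /= mxE.
by ring.
Qed.

(* The point at time [minn j N / N] on the segment from [base R k] to [t]. *)
Definition star k (j N : nat) (t : simplex R k) : simplex R k :=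
  exist (fun x => x \in simplex R k) _ (star_subproof j N t).

Lemma star_continuous k j N : continuous (@star k j N).
Proof.
apply: simplex_continuous => i.
rewrite (_ : (fun _ => _) = fun t : simplex R k => (1 - star_time j N) * set_val (base R k) 0 i +
  star_time j N * set_val t 0 i); last by apply/funext => t; rewrite !mxE.
apply: ctsD; first exact: cts_cst.
by apply: ctsM; [exact: cts_cst|exact: simplex_coord_continuous].
Qed.

Lemma star0 k N t : @star k 0 N t = base R k.
Proof. by apply: val_inj; rewrite /= /star_time min0n mul0r subr0 scale1r scale0r addr0. Qed.

Lemma starN k N t : (0 < N)%N -> @star k N N t = t.
Proof.
move=> N0; apply: val_inj; rewrite /= /star_time minnn divff ?pnatr_eq0 -?lt0n //.
by rewrite subrr scale0r add0r scale1r.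
Qed.

(** Consecutive points differ by at most [1 / N] in each coordinate, uniformly in [t]. Allowing
    every [N >= N0] lets two functions share a subdivision. *)
Lemma star_small k (f : simplex R k -> R) (e : R) : continuous f -> 0 < e ->
  exists2 N0, (0 < N0)%N & forall N j t, (N0 <= N)%N -> (j < N)%N ->
    `|f (star j N t) - f (star j.+1 N t)| < e.
Proof.
move=> fc e0; have [d d0 dP] := simplex_unif_continuous fc e0.
exists (Num.truncn d^-1).+1 => // N j t NN jN; apply: dP => i.
have N_gt0 : 0 < N%:R :> R by rewrite ltr0n (leq_ltn_trans _ jN).
have dN : N%:R^-1 < d.
  rewrite -[d]invrK ltf_pV2 ?posrE ?invr_gt0 //.
  apply: (lt_le_trans (truncnS_gt _)); rewrite ler_nat //.
rewrite /= !mxE /star_time (minn_idPl (ltnW jN)) (minn_idPl jN).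
have [b0 b1] := simplexP (base R k); have [t0 t1] := simplexP t.
set x := (i == 0)%:R; set y := set_val t 0 i.
have le1 (u : simplex R k) : 0 <= set_val u 0 i <= 1.
  have [u0 u1] := simplexP u; rewrite u0 -u1 (bigD1 i) //= lerDl sumr_ge0 //.
have -> : (1 - j%:R / N%:R) * x + j%:R / N%:R * y -
    ((1 - j.+1%:R / N%:R) * x + j.+1%:R / N%:R * y) = (x - y) / N%:R.
  by rewrite -natr1; field; rewrite gt_eqF.
rewrite normrM [`|_^-1|]gtr0_norm ?invr_gt0 //.
apply: le_lt_trans dN; apply: ler_piMl; first by rewrite invr_ge0 ltW.
rewrite ler_norml.
by have := le1 t; have := le1 (base R k); rewrite /= mxE -/x -/y; lra.
Qed.

(** Connectedness in discrete form: along the segment from the base vertex, steps smaller than 1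
    cannot change an integer. *)
Lemma int_valued_constant k (f : simplex R k -> R) :
  continuous f -> (forall t, exists z : int, f t = z%:~R) ->
  exists z : int, forall t, f t = z%:~R.
Proof.
move=> fc fint; have [z z_base] := fint (base R k); exists z => t.
have [N N0 small] := star_small fc (@ltr01 R).
suff E j : (j <= N)%N -> f (star j N t) = z%:~R by rewrite -(starN t N0) E.
elim: j => [|j IHj] jN; first by rewrite star0.
have := small N j t (leqnn N) jN; rewrite IHj ?(ltnW jN) //.
have [z' ->] := fint (star j.+1 N t).
rewrite -intrB -intr_norm -[1]/(1%:~R) ltr_int => zz'; congr (_%:~R).
by move: zz'; lia.
Qed.

Lemma circle_angle (a b : R) : a ^+ 2 + b ^+ 2 = 1 -> exists x, cos x = a /\ sin x = b.
Proof.
move=> ab1.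
have a1 : -1 <= a <= 1.
  by have := sqr_ge0 b; nra.
have sinE : sin (acos a) = `|b|.
  by rewrite sin_acos // -sqrtr_sqr; congr Num.sqrt; rewrite -ab1; ring.
have [b0|b0] := leP 0 b.
  by exists (acos a); rewrite acosK ?sinE ?ger0_norm // in_itv.
by exists (- acos a); rewrite cosN sinN acosK ?sinE ?ltr0_norm ?opprK //.
Qed.

Lemma cos_sin_atan (a b : R) : a ^+ 2 + b ^+ 2 = 1 -> 0 < a ->
  cos (atan (b / a)) = a /\ sin (atan (b / a)) = b.
Proof.
move=> ab1 a0.
have cosE : cos (atan (b / a)) = a.
  rewrite cos_atan.
  have -> : 1 + (b / a) ^+ 2 = a^-1 ^+ 2.
    by rewrite exprMn -[in LHS](divff (x := a ^+ 2)) ?sqrf_eq0 ?gt_eqF // exprVn -mulrDl ab1 mul1r.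
  by rewrite sqrtr_sqr gtr0_norm ?invr_gt0 // invrK.
split=> //; have := atanK (b / a); rewrite /tan cosE => /(congr1 ( *%R^~ a)).
by rewrite !divfK ?gt_eqF.
Qed.

Lemma cos_intD2pi (x : R) (z : int) : cos (x + z%:~R * (pi *+ 2)) = cos x.
Proof.
case: z => p; first by rewrite -pmulrn mulr_natl (periodicn (@cosD2pi R)).
rewrite -[LHS](periodicn (@cosD2pi R) p.+1); congr cos.
by rewrite NegzE mulrNz mulNr -pmulrn mulr_natl subrK.
Qed.

Lemma sin_intD2pi (x : R) (z : int) : sin (x + z%:~R * (pi *+ 2)) = sin x.
Proof.
case: z => p; first by rewrite -pmulrn mulr_natl (periodicn (@sinD2pi R)).
rewrite -[LHS](periodicn (@sinD2pi R) p.+1); congr sin.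
by rewrite NegzE mulrNz mulNr -pmulrn mulr_natl subrK.
Qed.

Lemma cos_eq1 (x : R) : cos x = 1 -> exists z : int, x = z%:~R * (pi *+ 2).
Proof.
have pi2 : 0 < pi *+ 2 :> R by rewrite pmulrn_lgt0 ?pi_gt0.
move=> cx1; pose z := Num.floor (x / (pi *+ 2)); exists z.
pose y := x - z%:~R * (pi *+ 2).
have cy : cos y = 1 by rewrite -(cos_intD2pi y z) subrK.
have /andP[y0 y2] : 0 <= y < pi *+ 2.
  have := floor_le (x / (pi *+ 2)); have := floorD1_gt (x / (pi *+ 2)).
  rewrite -/z ler_pdivlMr // ltr_pdivrMr // intrD mulrDl mul1r /y; lra.
apply/eqP; rewrite -subr_eq0 -/y; apply/eqP.
have [//|y_gt0] := eqVneq y 0.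
(* Otherwise [0 < y < 2 pi], and [cos y = 1 - 2 sin^2 (y / 2)] is less than 1. *)
have : 0 < sin (y / 2%:R).
  by apply: sin_gt0_pi; move: y0; rewrite le_eqVlt eq_sym (negPf y_gt0) /= => y0; lra.
have := cos_mulr2n (y / 2%:R); have -> : (y / 2%:R) *+ 2 = y by lra.
by rewrite cy; have := cos2Dsin2 (y / 2%:R); nra.
Qed.

(** Path lifting along all segments from the base vertex at once: each step turns by less than a
    quarter turn, so an arctangent corrects the angle continuously. *)
Lemma circle_lift k (f g : simplex R k -> R) : continuous f -> continuous g ->
  (forall t, f t ^+ 2 + g t ^+ 2 = 1) ->
  exists2 h, continuous h & forall t, cos (h t) = f t /\ sin (h t) = g t.
Proof.
move=> fc gc fg1; have [x [cx sx]] := circle_angle (fg1 (base R k)).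
have [Nf Nf0 smallf] := star_small fc (@ltr01 R).
have [Ng Ng0 smallg] := star_small gc (@ltr01 R).
pose N := (Nf + Ng)%N.
suff H j : (j <= N)%N -> exists2 h : simplex R k -> R, continuous h &
    forall t, cos (h t) = f (star j N t) /\ sin (h t) = g (star j N t).
  have [h hc hE] := H N (leqnn N); exists h => // t.
  by have := hE t; rewrite starN // addn_gt0 Nf0.
elim: j => [|j IHj] jN.
  by exists (fun=> x); [exact: cts_cst|move=> t; rewrite star0].
have [h hc hE] := IHj (ltnW jN).
have fj i : continuous (fun t => f (star i N t)).
  by move=> t; apply: continuous_comp; [exact: star_continuous|exact: fc].
have gj i : continuous (fun t => g (star i N t)).
  by move=> t; apply: continuous_comp; [exact: star_continuous|exact: gc].
(* [a + i b] is the quotient of two consecutive points of the circle. *)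
pose a t := f (star j N t) * f (star j.+1 N t) + g (star j N t) * g (star j.+1 N t).
pose b t := f (star j N t) * g (star j.+1 N t) - g (star j N t) * f (star j.+1 N t).
(* Unit vectors whose coordinates differ by less than 1 are at squared distance less than 2, so
   their inner product is positive. *)
have a_gt0 t : 0 < a t.
  have := fg1 (star j N t); have := fg1 (star j.+1 N t).
  have := smallf N j t (leq_addr _ _) jN; have := smallg N j t (leq_addl _ _) jN.
  rewrite /a !ltr_norml.
  move: (f _) (f _) (g _) (g _) => p u q v /andP[q1 q2] /andP[p1 p2] uv pq.
  have pu1 : (p - u) ^+ 2 < 1 by nra.
  have qv1 : (q - v) ^+ 2 < 1 by nra.
  by nra.
exists (fun t => h t + atan (b t / a t)).
  apply: ctsD => // t; apply: continuous_comp; last exact: continuous_atan.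
  apply: ctsM.
    by apply: ctsB; apply: ctsM; [exact: fj|exact: gj|exact: gj|exact: fj].
  apply: ctsV => [|{}t]; last by rewrite gt_eqF.
  by apply: ctsD; apply: ctsM; [exact: fj|exact: fj|exact: gj|exact: gj].
move=> t; have [ch sh] := hE t.
have [ca sa] : cos (atan (b t / a t)) = a t /\ sin (atan (b t / a t)) = b t.
  apply: cos_sin_atan => //.
  rewrite -[RHS]mulr1 -{2}(fg1 (star j N t)) -(fg1 (star j.+1 N t)) /a /b; ring.
rewrite cosD sinD ca sa ch sh /a /b; have := fg1 (star j N t).
move: (f _) (f _) (g _) (g _) => p u q v pq.
by split; [rewrite -[RHS]mulr1 -pq|rewrite -[RHS]mulr1 -pq]; ring.
Qed.
End Simplex.

(** * The circle *)

Section ComplexContinuous.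
Variable R : realType.

Lemma complex_continuous (X : topologicalType) (f : X -> R[i]^o) :
  continuous (fun x => complex.Re (f x)) -> continuous (fun x => complex.Im (f x)) ->
  continuous f.
Proof.
move=> ref imf x A /nbhs_ballP[e /= e0 eA].
have [r r0 re] : exists2 r : R, 0 < r & (r%:C)%C = e.
  exists (complex.Re e); last by rewrite RRe_real // gtr0_real.
  by move: e0; rewrite ltcE => /andP[].
have r2 : 0 < r / 2%:R by rewrite divr_gt0.
have nR : nbhs x ((fun x => complex.Re (f x)) @^-1` ball (complex.Re (f x)) (r / 2%:R)).
  by apply: ref; exact: nbhsx_ballx.
have nI : nbhs x ((fun x => complex.Im (f x)) @^-1` ball (complex.Im (f x)) (r / 2%:R)).
  by apply: imf; exact: nbhsx_ballx.
apply: filterS (filterI nR nI) => y [Ry Iy]; apply: eA.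
rewrite /ball /= -re normc_def ltcR.
move: Ry Iy; rewrite /ball /=.
case: (f x) (f y) => [a b] [c d] /=.
rewrite !ltr_norml => /andP[a1 a2] /andP[b1 b2].
rewrite -[ltRHS]ger0_norm ?ltW // -sqrtr_sqr ltr_sqrt ?exprn_gt0 //; nra.
Qed.

Lemma Re_continuous : continuous (fun z : R[i]^o => complex.Re z : R).
Proof.
move=> z A /nbhs_ballP[e /= e0 eA]; apply/nbhs_ballP; exists (e%:C)%C; first by rewrite /= ltcR.
move=> w; rewrite /ball /= => zw; apply: eA; rewrite /ball /=.
by have := le_lt_trans (normc_ge_Re (z - w)) zw; rewrite ltcR; case: z w {zw} => a b [].
Qed.

Lemma Im_continuous : continuous (fun z : R[i]^o => complex.Im z : R).
Proof.
move=> z A /nbhs_ballP[e /= e0 eA]; apply/nbhs_ballP; exists (e%:C)%C; first by rewrite /= ltcR.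
move=> w; rewrite /ball /= => zw; apply: eA; rewrite /ball /=.
move: zw; rewrite normc_def ltcR; case: z w => [a b] [c d] /=.
apply: le_lt_trans; rewrite -sqrtr_sqr ler_wsqrtr //.
by rewrite lerDr sqr_ge0.
Qed.

End ComplexContinuous.

Section Circle.
Variable R : realType.
Local Notation circle := (@Defs.circle R).

Lemma circleP (z : circle) : complex.Re (set_val z) ^+ 2 + complex.Im (set_val z) ^+ 2 = 1.
Proof.
have /(congr1 (fun x => complex.Re x ^+ 2)) := set_mem (valP z).
rewrite normc_def /= expr1n sqr_sqrtr // addr_ge0 ?sqr_ge0 //.
Qed.

Fact circ_subproof (x : R) : ((cos x +i* sin x)%C : R[i]^o) \in circle.
Proof. by apply/mem_set; rewrite /circle /= normc_def /= cos2Dsin2 sqrtr1. Qed.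

Definition circ (x : R) : circle := exist (fun z => z \in circle) _ (circ_subproof x).

Lemma circle_eq (z w : circle) : complex.Re (set_val z) = complex.Re (set_val w) ->
  complex.Im (set_val z) = complex.Im (set_val w) -> z = w.
Proof.
move=> re im; apply: val_inj; change (set_val z = set_val w :> R[i]).
by apply/eqP; rewrite eq_complex re im !eqxx.
Qed.

Lemma circ_eq (x y : R) : circ x = circ y <-> exists z : int, y = x + z%:~R * (pi *+ 2).
Proof.
split=> [|[z ->]].
  move=> /(congr1 (fun z => (set_val z : R[i]))) [c s].
  have : cos (y - x) = 1 by rewrite cosB c s -!expr2 cos2Dsin2.
  by move=> /cos_eq1[z E]; exists z; rewrite -E addrC subrK.
by apply: circle_eq; rewrite /= ?cos_intD2pi ?sin_intD2pi.
Qed.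

Lemma circ_opp x : circ (x + pi) = circle_opp (circ x).
Proof. by apply: circle_eq; rewrite /= ?cosDpi ?sinDpi. Qed.

Lemma circ_conj x : circ (- x) = circle_conj (circ x).
Proof. by apply: circle_eq; rewrite /= ?cosN ?sinN. Qed.

Lemma circ_continuous : continuous circ.
Proof.
apply: continuous_comp_initial; apply: complex_continuous => x.
  exact: continuous_cos.
exact: continuous_sin.
Qed.

Lemma circ_neq_opp x : circ x <> circle_opp (circ x).
Proof.
move=> /(congr1 (fun z => (set_val z : R[i]))) /= [c s].
have := cos2Dsin2 x; have -> : cos x = 0 by lra.
have -> : sin x = 0 by lra.
by rewrite expr0n add0r => /eqP; rewrite eq_sym oner_eq0.
Qed.


End Circle.

(** * Lifting simplices of K_n *)

Lemma prod_continuous (X : topologicalType) (I : choiceType) (U : I -> topologicalType)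
    (f : X -> prod_topology U) :
  (forall i, continuous (fun x => f x i)) -> continuous f.
Proof.
move=> fc x; apply/cvg_sup => i; move: x.
apply/(@continuousP _ (initial_topology (@^~ i))) => A [B oB <-].
by move/continuousP: (fc i) => /(_ B oB).
Qed.

(** The squared distance of two unit vectors is 2 minus twice their inner product. *)
Lemma unit_vector_eq (R : realType) (a b p q : R) :
  a ^+ 2 + b ^+ 2 = 1 -> p ^+ 2 + q ^+ 2 = 1 -> p * a + q * b = 1 -> a = p /\ b = q.
Proof.
move=> ab pq E; have : (a - p) ^+ 2 + (b - q) ^+ 2 = 0 by nra.
move=> /eqP; rewrite paddr_eq0 ?sqr_ge0 // !sqrf_eq0 !subr_eq0.
by move=> /andP[/eqP-> /eqP->].
Qed.

Section KleinProjection.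
Variables (R : realType) (m : nat).
Local Notation n := m.+1.
Local Notation K := (klein_bottle R n).

Definition klein_pi (z : torus R n) : K :=
  \pi_(quotient_topology {eq_quot klein_equivRel R n}) z.

Lemma klein_pi_continuous : continuous klein_pi.
Proof. exact: pi_continuous. Qed.

Lemma klein_piP z w : klein_pi z = klein_pi w <-> w = z \/ w = klein_swap z.
Proof.
split=> [/eqmodP|E]; last first.
  by apply/eqmodP; rewrite /= /klein_rel; case: E => ->; rewrite eqxx ?orbT.
by case/orP => /eqP; auto.
Qed.

Lemma klein_pi_surj (x : K) : exists z, x = klein_pi z.
Proof. by exists (repr x); rewrite /klein_pi reprK. Qed.

Lemma klein_invariant_continuous (f : torus R n -> R) : continuous f ->
  (forall z, f (klein_swap z) = f z) ->
  exists2 g : K -> R, continuous g & forall z, g (klein_pi z) = f z.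
Proof.
move=> fc fswap; exists (f \o repr).
  apply: repr_comp_continuous => // z w /eqP/klein_piP[->|->]; rewrite ?fswap //.
move=> z /=; have : klein_pi (repr (klein_pi z)) = klein_pi z by rewrite /klein_pi reprK.
by move: (repr _) => r /klein_piP[->|->].
Qed.

Definition torus_point (x : 'I_n -> R) : torus R n := fun l => circ (x l).

Lemma klein_swap_ord_max (z : torus R n) (l : 'I_n) :
  klein_swap z l = if l == m :> nat then circle_opp (z l) else circle_conj (z l).
Proof. by []. Qed.

Lemma klein_swap_point (x : 'I_n -> R) :
  klein_swap (torus_point x) =
  torus_point (fun l => if (l < m)%N then - x l else x l + pi).
Proof.
apply/funext => l; rewrite klein_swap_ord_max /torus_point.
have := ltn_ord l; rewrite ltnS leq_eqVlt; case: eqP => [->|_ /= lm].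
  by rewrite ltnn circ_opp.
by rewrite lm circ_conj.
Qed.

Fact klein_proj_subproof k (s : real_simplex R n k) :
  continuous (fun t => klein_pi (torus_point (fun l => s l t))).
Proof.
move=> t; apply: continuous_comp; last exact: klein_pi_continuous.
apply: prod_continuous => l {}t.
by apply: continuous_comp; [exact: cts_fun|exact: circ_continuous].
Qed.

Definition klein_proj k (s : real_simplex R n k) : singular_simplex R K k :=
  mkcts (@klein_proj_subproof k s).

Lemma klein_proj_eq k (s s' : real_simplex R n k) :
  klein_proj s = klein_proj s' <-> forall t,
    klein_pi (torus_point (fun l => s l t)) = klein_pi (torus_point (fun l => s' l t)).
Proof.
split=> [E t|E]; last by apply/continuousEP => t; exact: E.
exact: (congr1 (fun f : singular_simplex R K k => f t) E).
Qed.

Lemma klein_proj_face i k (s : real_simplex R n k.+1) :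
  klein_proj (real_face i s) = (klein_proj s \o face (inord i) : singular_simplex R K k).
Proof. by apply/continuousEP => t. Qed.

Lemma klein_proj_shift i k (s : real_simplex R n k) :
  klein_proj (shift i (pi *+ 2) s) = klein_proj s.
Proof.
apply/klein_proj_eq => t; congr klein_pi; apply/funext => l; apply/circ_eq.
rewrite shiftE; case: eqP => _; last by exists 0; rewrite mul0r !addr0.
by exists (-1); rewrite mulrN1z mulN1r addrK.
Qed.

Lemma klein_proj_glide k (s : real_simplex R n k) :
  klein_proj (glide (pi *+ 2) s) = klein_proj s.
Proof.
apply/klein_proj_eq => t; apply/esym/klein_piP; right.
rewrite klein_swap_point; congr torus_point; apply/funext => l; rewrite /glide.
have -> : pi *+ 2 / 2%:R = pi :> R by lra.
rewrite shiftE reflectE.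
have := ltn_ord l; rewrite ltnS leq_eqVlt; case: eqP => [->|_ /= ->].
  by rewrite ltnn.
by rewrite addr0.
Qed.

Lemma coord_re_continuous (l : 'I_n) :
  continuous (fun z : torus R n => complex.Re (set_val (z l)) : R).
Proof.
move=> z; apply: (@continuous_comp _ _ _ (fun z : torus R n => set_val (z l) : R[i]^o)
  (fun w : R[i]^o => complex.Re w : R)); last exact: Re_continuous.
apply: (@continuous_comp _ _ _ (fun z : torus R n => z l) set_val).
  exact: proj_continuous.
exact: initial_continuous.
Qed.

Lemma coord_im_continuous (l : 'I_n) :
  continuous (fun z : torus R n => complex.Im (set_val (z l)) : R).
Proof.
move=> z; apply: (@continuous_comp _ _ _ (fun z : torus R n => set_val (z l) : R[i]^o)
  (fun w : R[i]^o => complex.Im w : R)); last exact: Im_continuous.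
apply: (@continuous_comp _ _ _ (fun z : torus R n => z l) set_val).
  exact: proj_continuous.
exact: initial_continuous.
Qed.

Let swap_re z (l : 'I_n) : complex.Re (set_val (@klein_swap R n z l)) =
  if l == m :> nat then - complex.Re (set_val (z l)) else complex.Re (set_val (z l)).
Proof.
rewrite klein_swap_ord_max; case: ifP => _ /=.
  by case: (z l) => -[a b] ab.
by case: (z l) => -[a b] ab.
Qed.

Let swap_im z (l : 'I_n) :
  complex.Im (set_val (@klein_swap R n z l)) = - complex.Im (set_val (z l)).
Proof.
rewrite klein_swap_ord_max; case: ifP => _ /=.
  by case: (z l) => -[a b] ab.
by case: (z l) => -[a b] ab.
Qed.

(* The last coordinate [w] of a lift is a square root of the invariant function *)
(* [z_m ^ 2]; the others are recovered from the invariants [Re z_l], [z_m Im z_l]. *)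
Lemma klein_proj_surj k (f : singular_simplex R K k) : exists s, f = klein_proj s.
Proof.
pose re (l : 'I_n) (z : torus R n) := complex.Re (set_val (z l)) : R.
pose im (l : 'I_n) (z : torus R n) := complex.Im (set_val (z l)) : R.
have re_c l : continuous (re l) by exact: coord_re_continuous.
have im_c l : continuous (im l) by exact: coord_im_continuous.
pose M : 'I_n := ord_max.
have swap_reM z : re M (klein_swap z) = - re M z by rewrite /re swap_re eqxx.
have swap_imM z : im M (klein_swap z) = - im M z by rewrite /im swap_im.
have f_c : continuous f by exact: cts_fun.
(* [c1] and [c2] are the real and imaginary parts of the square of [z M], which the sign change of
   the swap preserves. *)
have [c1 c1_c c1E] : exists2 g : K -> R, continuous g &
    forall z, g (klein_pi z) = re M z ^+ 2 - im M z ^+ 2.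
  apply: klein_invariant_continuous => [|z]; last by rewrite swap_reM swap_imM !sqrrN.
  by apply: ctsB; apply: ctsM.
have [c2 c2_c c2E] : exists2 g : K -> R, continuous g &
    forall z, g (klein_pi z) = 2%:R * (re M z * im M z).
  apply: klein_invariant_continuous => [|z]; last by rewrite swap_reM swap_imM mulrNN.
  by apply: ctsM; [exact: cts_cst|apply: ctsM].
have [h h_c hE] : exists2 h : simplex R k -> R, continuous h & forall t,
    cos (h t) = c1 (f t) /\ sin (h t) = c2 (f t).
  apply: circle_lift => [t|t|t].
  - by apply: continuous_comp; [exact: f_c|exact: c1_c].
  - by apply: continuous_comp; [exact: f_c|exact: c2_c].
  - have [z ->] := klein_pi_surj (f t); rewrite c1E c2E.
    have := circleP (z M); rewrite -/(re M z) -/(im M z).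
    move: (re M z) (im M z) => a b ab.
    by transitivity ((a ^+ 2 + b ^+ 2) ^+ 2); [ring|rewrite ab expr1n].
pose w t := h t / 2%:R.
have w_c : continuous w by apply: ctsM => //; exact: cts_cst.
have hw t : h t = w t *+ 2 by rewrite /w; lra.
(* [z M] and [circ (w t)] have the same square, so they agree up to sign, and the swap corrects the
   sign. *)
have lift_last t : exists2 z, klein_pi z = f t & z M = circ (w t).
  have [z Ez] := klein_pi_surj (f t).
  have [] := hE t; rewrite Ez c1E c2E hw cos_mulr2n sin_mulr2n.
  have := circleP (z M); rewrite -/(re M z) -/(im M z) => ab cE sE.
  have pq := cos2Dsin2 (w t).
  have : (cos (w t) * re M z + sin (w t) * im M z - 1) *
    (cos (w t) * re M z + sin (w t) * im M z + 1) = 0.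
    move: (re M z) (im M z) (cos (w t)) (sin (w t)) ab cE sE pq => a b p q ab cE sE pq.
    have pa : p ^+ 2 = a ^+ 2 by nra.
    have qb : q ^+ 2 = b ^+ 2 by nra.
    have E : p * q = a * b by lra.
    transitivity (p ^+ 2 * a ^+ 2 + (p * q) * (a * b) *+ 2 + q ^+ 2 * b ^+ 2 - 1); first by ring.
    by rewrite pa qb E -[X in _ - X](expr1n _ 2) -ab; ring.
  move=> /eqP; rewrite mulf_eq0 => /orP[/eqP E|/eqP E].
    have [re_E im_E] : re M z = cos (w t) /\ im M z = sin (w t).
      by apply: unit_vector_eq => //; lra.
    by exists z => //; apply: circle_eq.
  have [re_E im_E] : - re M z = cos (w t) /\ - im M z = sin (w t).
    by apply: unit_vector_eq; rewrite ?sqrrN // !mulrN; lra.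
  exists (klein_swap z); first by apply/esym/klein_piP; right.
  by apply: circle_eq; rewrite /= -/(re M _) -/(im M _) ?swap_reM ?swap_imM.
have /choice[s sP] : forall l : 'I_n, exists g : continuousType (simplex R k) R,
    forall t z, klein_pi z = f t -> z M = circ (w t) -> z l = circ (g t).
  move=> l; have := ltn_ord l; rewrite ltnS leq_eqVlt => /orP[/eqP lM|lm].
    by exists (mkcts w_c) => t z _ <-; congr z; exact: val_inj.
  have lM : (l == m :> nat) = false by rewrite ltn_eqF.
  have [A A_c AE] : exists2 g : K -> R, continuous g & forall z, g (klein_pi z) = re l z.
    by apply: klein_invariant_continuous => // z; rewrite /re swap_re lM.
  have [B1 B1_c B1E] : exists2 g : K -> R, continuous g &
      forall z, g (klein_pi z) = re M z * im l z.
    apply: klein_invariant_continuous => [|z]; first exact: ctsM.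
    by rewrite swap_reM /im swap_im mulrNN.
  have [B2 B2_c B2E] : exists2 g : K -> R, continuous g &
      forall z, g (klein_pi z) = im M z * im l z.
    apply: klein_invariant_continuous => [|z]; first exact: ctsM.
    by rewrite swap_imM /im swap_im mulrNN.
  (* [B1] and [B2] are the parts of [z M] times [Im (z l)]; pairing them with the unit vector
     [z M = circ (w t)] leaves [Im (z l)]. *)
  pose c t := A (f t); pose d t := cos (w t) * B1 (f t) + sin (w t) * B2 (f t).
  have cE t z : klein_pi z = f t -> c t = re l z by rewrite /c => <-; rewrite AE.
  have dE t z : klein_pi z = f t -> z M = circ (w t) -> d t = im l z.
    rewrite /d => <- zM; rewrite B1E B2E /re /im zM /= !mulrA -mulrDl.
    by rewrite -!expr2 cos2Dsin2 mul1r.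
  have [g g_c gE] : exists2 g : simplex R k -> R, continuous g &
      forall t, cos (g t) = c t /\ sin (g t) = d t.
    apply: circle_lift => [t||t].
    - by apply: continuous_comp; [exact: f_c|exact: A_c].
    - apply: ctsD; apply: ctsM.
      + by move=> t; apply: continuous_comp; [exact: w_c|exact: continuous_cos].
      + by move=> t; apply: continuous_comp; [exact: f_c|exact: B1_c].
      + by move=> t; apply: continuous_comp; [exact: w_c|exact: continuous_sin].
      + by move=> t; apply: continuous_comp; [exact: f_c|exact: B2_c].
    - have [z zf zM] := lift_last t; rewrite (cE t z zf) (dE t z zf zM).
      exact: circleP.
  exists (mkcts g_c) => t z zf zM; have [cg sg] := gE t.
  by apply: circle_eq; rewrite /= /mkcts ?cg ?sg; [rewrite (cE t z)|rewrite (dE t z)].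
exists s; apply/continuousEP => t; have [z zf zM] := lift_last t.
by rewrite /= /mkcts -zf; congr klein_pi; apply/funext => l; exact: sP.
Qed.

End KleinProjection.

(** * Lifts of the same simplex *)

Section DeckOrbits.
Variables (R : realType) (m : nat).
Local Notation n := m.+1.
Local Notation T := (pi *+ 2 : R).

Section Adjacent.
Variable k : nat.
Local Notation ch := ({freeg (real_simplex R n k) / rat} : lmodType rat).
Implicit Types s : real_simplex R n k.

Definition deck_equiv s s' := @deck_sub R m T k (<< s >> - << s' >> : ch).

Let N_sub : submodule (@deck_sub R m T k) := (deck_subcomplex m T).1 k.

Lemma deck_equiv_refl s : deck_equiv s s.
Proof. by rewrite /deck_equiv subrr; exact: submodule0. Qed.

Lemma deck_equiv_sym s s' : deck_equiv s s' -> deck_equiv s' s.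
Proof. by move=> /(submoduleN N_sub); rewrite opprB. Qed.

Lemma deck_equiv_trans s1 s2 s3 : deck_equiv s1 s2 -> deck_equiv s2 s3 -> deck_equiv s1 s3.
Proof. by move=> E /(submoduleD N_sub E); rewrite subrKA. Qed.

Lemma deck_equiv_glide s : deck_equiv s (glide T s).
Proof.
rewrite /deck_equiv -(freeg_mapE rat (@glide R m T k)) -glide_reflectionE.
apply: wang_sub1; apply: tower_subcomplex => *; exact: affine_d.
Qed.

Lemma tower_sub1 j i c : (i < j)%N ->
  tower (@translation R m T) j k (c - translation m T i k c).
Proof.
have td i' k' x : @translation R m T i' k' (free_d rat (@real_face R n) k' x) =
    free_d rat (@real_face R n) k' (translation m T i' k'.+1 x) by exact: affine_d.
elim: j => [//|j IHj]; rewrite ltnS leq_eqVlt => /orP[/eqP->|/IHj].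
  exact: (wang_sub1 _ (tower_subcomplex td j)).
exact: wang_subW.
Qed.

Lemma deck_equiv_shift j s : (j < m)%N -> deck_equiv s (shift j T s).
Proof.
move=> jm; rewrite /deck_equiv -(freeg_mapE rat (@shift R m j T k)).
by apply: wang_subW; exact: tower_sub1.
Qed.

(** This translation is the square of the glide reflection. *)
Lemma deck_equiv_shift_last s : deck_equiv s (shift m T s).
Proof.
have -> : shift m T s = glide T (glide T s).
  apply: real_simplexP => l t; rewrite /glide !(shiftE, reflectE).
  have := ltn_ord l; rewrite ltnS leq_eqVlt.
  by case: eqP => [->|_ /= ->]; rewrite ?ltnn; lra.
exact: deck_equiv_trans (deck_equiv_glide s) (deck_equiv_glide _).
Qed.

Lemma deck_equiv_shift_int j (z : int) s : (j < n)%N ->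
  deck_equiv s (shift j (z%:~R * T) s).
Proof.
have nat_case (p : nat) s1 : (j < n)%N -> deck_equiv s1 (shift j (p%:R * T) s1).
  move=> jn; elim: p => [|p IHp].
    rewrite (_ : shift j _ s1 = s1); first exact: deck_equiv_refl.
    by apply: real_simplexP => l t; rewrite shiftE mul0r; case: ifP; rewrite addr0.
  apply: (deck_equiv_trans IHp).
  have -> : shift j (p.+1%:R * T) s1 = shift j T (shift j (p%:R * T) s1).
    by apply: real_simplexP => l t; rewrite !shiftE -natr1; case: ifP => _; ring.
  move: jn; rewrite ltnS leq_eqVlt => /orP[/eqP->|]; last exact: deck_equiv_shift.
  exact: deck_equiv_shift_last.
move=> jn; case: z => p; first exact: nat_case.
apply: deck_equiv_sym; rewrite NegzE mulrNz mulNr -pmulrn.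
by have := nat_case p.+1 (shift j (- (p.+1%:R * T)) s) jn; rewrite shiftNK.
Qed.

Lemma deck_equiv_shifts s s' (z : 'I_n -> int) :
  (forall l t, s' l t = s l t + (z l)%:~R * T) -> deck_equiv s s'.
Proof.
move=> ss'; pose mix j : real_simplex R n k := fun l => if (l < j)%N then s' l else s l.
suff H j : (j <= n)%N -> deck_equiv s (mix j).
  have := H n (leqnn n); congr (deck_equiv _ _).
  by apply/funext => l; rewrite /mix ltn_ord.
elim: j => [|j IHj] jn.
  rewrite (_ : mix 0%N = s); first exact: deck_equiv_refl.
  by apply/funext => l; rewrite /mix ltn0.
apply: (deck_equiv_trans (IHj (ltnW jn))).
have -> : mix j.+1 = shift j ((z (Ordinal jn))%:~R * T) (mix j).
  apply: real_simplexP => l t; rewrite shiftE /mix ltnS leq_eqVlt.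
  case: eqP => [lj|_] /=; last by rewrite addr0.
  by rewrite lj ltnn ss'; congr (_ + (z _)%:~R * _); exact: val_inj.
exact: deck_equiv_shift_int.
Qed.

End Adjacent.

Lemma simplex_real_sub_continuous k (s s' : real_simplex R n k) l :
  continuous (fun t => s' l t - s l t).
Proof. by apply: ctsB; exact: cts_fun. Qed.

Lemma coord_diff_constant k (s s' : real_simplex R n k) (c : R) l : 0 < c ->
  (forall t, exists z : int, s' l t = s l t + z%:~R * c) ->
  exists z : int, forall t, s' l t = s l t + z%:~R * c.
Proof.
move=> c0 ss'; have [|t|z zP] := @int_valued_constant R k (fun t => (s' l t - s l t) / c).
- by apply: ctsM; [exact: simplex_real_sub_continuous|exact: cts_cst].
- by have [z ->] := ss' t; exists z; rewrite addrC addKr mulfK ?gt_eqF.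
by exists z => t; rewrite -(zP t) divfK ?gt_eqF // addrC subrK.
Qed.

(** The last coordinates differ by a constant multiple of [pi]. If it is even, the swap never
    relates the two lifts, since it would negate the last point, and all coordinates differ by
    constant multiples of [T]. If it is odd, a glide reduces to the even case. *)
Lemma klein_proj_inj k (s s' : real_simplex R n k) :
  klein_proj s = klein_proj s' -> deck_equiv s s'.
Proof.
have pi2 : 0 < T by rewrite pmulrn_lgt0 ?pi_gt0.
move=> ss'.
have fiber s1 t : klein_proj s1 = klein_proj s' ->
    torus_point (fun l => s' l t) = torus_point (fun l => s1 l t) \/
    torus_point (fun l => s' l t) = klein_swap (torus_point (fun l => s1 l t)).
  by move=> /klein_proj_eq/(_ t)/klein_piP.
pose M : 'I_n := ord_max.
have even s1 : klein_proj s1 = klein_proj s' ->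
    (exists z : int, forall t, s' M t = s1 M t + z%:~R * T) -> deck_equiv s1 s'.
  move=> s1s' [z zP].
  have /choice[w wP] : forall l, exists z : int, forall t, s' l t = s1 l t + z%:~R * T.
    move=> l; apply: coord_diff_constant => // t; apply/circ_eq.
    have [/(congr1 (fun x => x l)) E|/(congr1 (fun x => x M))] := fiber s1 t s1s'.
      exact: esym E.
    rewrite klein_swap_ord_max eqxx /torus_point.
    have -> : circ (s' M t) = circ (s1 M t) by apply/esym/circ_eq; exists z.
    by move=> /circ_neq_opp.
  exact: deck_equiv_shifts wP.
have [z zP] : exists z : int, forall t, s' M t = s M t + z%:~R * pi.
  apply: coord_diff_constant => [|t]; first exact: pi_gt0.
  have [/(congr1 (fun x => x M)) E|/(congr1 (fun x => x M))] := fiber s t ss'.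
    by have /circ_eq[z ->] := esym E; exists (z * 2); rewrite intrM; congr (_ + _); ring.
  rewrite klein_swap_ord_max eqxx /torus_point -circ_opp => E.
  by have /circ_eq[z ->] := esym E; exists (z * 2 + 1); rewrite intrD intrM; ring.
have [[w zE]|[w zE]] : (exists w : int, z = w * 2) \/ exists w : int, z = w * 2 + 1.
  have := divz_eq z 2; have := ltz_pmod z (isT : (0 < 2 :> int)).
  have := modz_ge0 z (isT : (2 != 0 :> int)) => m0 m2 zE.
  have [E|E] : (z %% 2)%Z = 0 \/ (z %% 2)%Z = 1 by lia.
    by left; exists (z %/ 2)%Z; rewrite {1}zE E addr0.
  by right; exists (z %/ 2)%Z; rewrite {1}zE E.
- by apply: even => //; exists w => t; rewrite zP zE intrM; ring.
apply: (deck_equiv_trans (deck_equiv_glide s)).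
apply: even; first by rewrite klein_proj_glide.
exists w => t; rewrite zP zE /glide shiftE reflectE eqxx ltnn intrD intrM.
by rewrite -[T]mulr_natr mulfK ?pnatr_eq0 //; ring.
Qed.

End DeckOrbits.

(** * The homology of K_n *)

Lemma has_dim_lquot (F : fieldType) (V : lmodType F) (S : submodClosed V) b :
  basis_mod (fun=> True) (fun v => v \in S) b -> has_dim (lquot S) b.
Proof.
move=> [e [_ free_e span_e]].
have lquot_pi0 : lquot_pi S 0 = 0.
  by apply: (addrI (lquot_pi S 0)); rewrite -lquot_piD !addr0.
have sumE (a : 'I_b -> F) :
    \sum_i a i *: lquot_pi S (e i) = lquot_pi S (\sum_i a i *: e i).
  rewrite (big_morph (lquot_pi S) (lquot_piD S) lquot_pi0).
  by apply: eq_bigr => i _; rewrite lquot_piZ.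
exists (fun i => lquot_pi S (e i)); split=> [a|x].
  rewrite sumE -lquot_pi0 => /eqP; rewrite lquot_piE subr0; exact: free_e.
have [v ->] := lquot_piP x; have [a Sa] := span_e v I.
by exists a; apply/eqP; rewrite sumE lquot_piE.
Qed.

Section Transfer.
Variables (R : realType) (m : nat).
Local Notation n := m.+1.
Local Notation K := (klein_bottle R n).
Local Notation T := (pi *+ 2 : R).
Local Notation d := (free_d rat (@real_face R n)).
Local Notation N := (@deck_sub R m T).
Local Notation ch k := ({freeg (real_simplex R n k) / rat} : lmodType rat).

Definition klein_chain (k : nat) : {linear ch k -> chain R rat K k} :=
  freeg_map rat (@klein_proj R m k).

Lemma boundary_klein_chain k (c : ch k.+1) :
  boundary (klein_chain k.+1 c) = klein_chain k (d k c).
Proof.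
have := @freeg_ext rat _ _ (@boundary R rat K k \o klein_chain k.+1) (klein_chain k \o d k) _ c.
apply=> s /=; rewrite freeg_mapE free_dE linear_sum /boundary fglift1.
apply: eq_bigr => i _; rewrite linearZ /= freeg_mapE klein_proj_face inord_val.
by congr (_ *: << _ >>).
Qed.

Lemma klein_chain_deck k (c : ch k) : N k c -> klein_chain k c = 0.
Proof.
have map_invariant (f : real_simplex R n k -> real_simplex R n k) (x : ch k) :
    (forall s, klein_proj (f s) = klein_proj s) ->
    klein_chain k (freeg_map rat f x) = klein_chain k x.
  move=> fP; rewrite /klein_chain freeg_map_comp; congr (freeg_map _ _ _).
  exact/funext.
suff tower0 j x : (j <= m)%N -> tower (@translation R m T) j k x -> klein_chain k x = 0.
  move=> [b /tower0] => /(_ (leqnn m)).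
  rewrite glide_reflectionE linearB [klein_chain _ (b - _)]linearB.
  by rewrite map_invariant; [rewrite subrr subr0|exact: klein_proj_glide].
elim: j x => [|j IHj] x jm /=; first by move=> ->; rewrite linear0.
move=> [b /IHj] => /(_ (ltnW jm)).
rewrite linearB [klein_chain _ (b - _)]linearB.
by rewrite map_invariant; [rewrite subrr subr0|exact: klein_proj_shift].
Qed.

Let section_exists k : exists q : singular_simplex R K k -> real_simplex R n k,
  forall f, klein_proj (q f) = f.
Proof.
have /choice[q qP] := @klein_proj_surj R m k.
by exists q => f; rewrite -qP.
Qed.

(** For a section [q] of the projection, each simplex is congruent to [q] of its image by
    [klein_proj_inj]; this extends linearly to chains. *)
Lemma klein_chain_ker k (c : ch k) : klein_chain k c = 0 -> N k c.
Proof.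
have [q qP] := section_exists k.
have N_sub := (deck_subcomplex m T).1 k.
suff H (x : ch k) : N k (x - freeg_map rat q (klein_chain k x)).
  by move=> c0; have := H c; rewrite c0 linear0 subr0.
move: x; apply: (@freeg_ind rat (real_simplex R n k)) => [|s].
  split=> [|a x y Nx Ny]; first by rewrite 2!linear0 subr0; exact: submodule0.
  have := submoduleD N_sub (submoduleZ N_sub a Nx) Ny.
  congr (deck_sub _ _ _).
  by rewrite [in RHS]linearP [in RHS]linearP /= scalerBr; zmod.
by rewrite /klein_chain !freeg_mapE; apply: klein_proj_inj; rewrite qP.
Qed.

Lemma klein_chain_surj k (c : chain R rat K k) : exists x, c = klein_chain k x.
Proof.
have [q qP] := section_exists k; exists (freeg_map rat q c).
by rewrite /klein_chain freeg_map_comp freeg_map_id.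
Qed.

(** Since [klein_chain] is onto with kernel [N], cycles and boundaries downstairs correspond to
    [cyc] and [bnd] upstairs, and the basis of [deck_dim] is carried over. *)
Lemma klein_homology_dim k :
  has_dim (homology R rat K k) (if odd k then 'C(m, k.-1) else 'C(m, k)).
Proof.
have T_gt0 : 0 < T by rewrite pmulrn_lgt0 ?pi_gt0.
have [e [cyc_e free_e span_e]] := deck_dim m T_gt0 k.
have cycE (c : ch k) : is_cycle (klein_chain k c) <-> cyc d N k c.
  case: k {e cyc_e free_e span_e} c => [//|k] c /=.
  rewrite boundary_klein_chain; split=> [/eqP|/klein_chain_deck->//].
  exact: klein_chain_ker.
have bndE (z : cycles R rat K k) (c : ch k) : val z = klein_chain k c ->
    z \in @is_boundary R rat K k <-> bnd d N k c.
  move=> zc; rewrite unfold_in /= /is_boundary zc; split=> [/asboolP[y]|[y [x [Nx ->]]]].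
    have [y' ->] := klein_chain_surj y; rewrite boundary_klein_chain => E.
    exists y', (c - d k y'); split; last by rewrite addrC subrK.
    by apply: klein_chain_ker; rewrite linearB E subrr.
  apply/asboolP; exists (klein_chain k.+1 y).
  by rewrite boundary_klein_chain linearD /= (klein_chain_deck Nx) addr0.
apply: has_dim_lquot.
pose e' i : cycles R rat K k := exist (fun c => is_cycle c) _ ((cycE (e i)).2 (cyc_e i)).
have val_sum a : val (\sum_i a i *: e' i) = klein_chain k (\sum_i a i *: e i).
  by rewrite !linear_sum; apply: eq_bigr => i _; rewrite !linearZ.
exists e'; split=> // [a|z _].
  by move=> /(bndE _ _ (val_sum a)); exact: free_e.
have [c zc] := klein_chain_surj (val z).
have [|a Ba] := span_e c; first by apply/cycE; rewrite -zc; exact: valP.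
exists a; apply/(bndE _ (c - \sum_i a i *: e i)) => //.
by rewrite linearB /= val_sum [RHS]linearB -zc.
Qed.

End Transfer.

Theorem theorem2p12 (R : realType) (n i : nat) (hn : (1 <= n)%N) :
  has_dim (homology R rat (klein_bottle R n) i)
    (if odd i then 'C(n.-1, i.-1) else 'C(n.-1, i)).
Proof. by case: n hn => [//|m] _; exact: klein_homology_dim. Qed.
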